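(* If an ETF of type $(K,-1,S)$ exists where $\frac{K-2}{S-1}\in\mathbb{Z}$, and a $\mathrm{TD}(K,M)$ exists where $M=S(K-1)-1$, then an ETF of type $(K,-1,\tfrac{MU+1}{K-1})$ exists when either: (i) $U=1$ or $U=K$; (ii) a $\mathrm{BIBD}(U,K,1)$ exists; (iii) $U=K^J$ for some $J\ge2$, provided a $\mathrm{TD}(K,MK^j)$ exists for all $j=1,\dots,J-1$. As a consequence, an ETF of type $(K,-1,S)$ exists when either: (a) $K=6$, $S=\frac15(9U+1)$ where either $U=6^J$ for some $J\ge0$ or a $\mathrm{BIBD}(U,6,1)$ exists; (b) $K=6$, $S=\frac15(24U+1)$ where either $U=6^J$ for some $J\ge0$ or a $\mathrm{BIBD}(U,6,1)$ exists; (c) $K=7$, $S=\frac16(35U+1)$ where either $U=7^J$ for some $J\ge0$ or a $\mathrm{BIBD}(U,7,1)$ exists; (d) $K=10$, $S=\frac19(80U+1)$ where either $U=10^J$ for some $J\ge0$ or a $\mathrm{BIBD}(U,10,1)$ exists; (e) $K=12$, $S=\frac1{11}(32U+1)$ where either $U=12^J$ for some $J\ge0$ or a $\mathrm{BIBD}(U,12,1)$ exists.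
   Context: ETFs. An equiangular tight frame $\mathrm{ETF}(D,N)$ for $\mathbb{F}^D$ ($\mathbb{F}=\mathbb{R}$ or $\mathbb{C}$) is a sequence $\{\boldsymbol{\varphi}_n\}_{n=1}^N$ of nonzero vectors in $\mathbb{F}^D$, all of the same norm, such that $|\langle\boldsymbol{\varphi}_n,\boldsymbol{\varphi}_{n'}\rangle|$ is constant over all $n\ne n'$ and there is $A>0$ with $\sum_{n=1}^N|\langle\boldsymbol{\varphi}_n,\mathbf{x}\rangle|^2=A\|\mathbf{x}\|^2$ for all $\mathbf{x}\in\mathbb{F}^D$. ETFs may be complex, i.e. existence means existence over $\mathbb{C}$. Types. Given integers $D,N$ with $1<D<N$, the pair $(D,N)$ is of type $(K,L,S)$ if $$D=\tfrac{S}{K}[S(K-1)+L]=S^2-\tfrac{S(S-L)}{K},\qquad N=(S+L)[S(K-1)+L],$$ where $K$ and $S$ are integers with $S>0$, and $L\in\{1,-1\}$. An $\mathrm{ETF}(D,N)$ is of type $(K,L,S)$ if $(D,N)$ is. Designs. For $K\ge2$, a $K$-GDD of type $M^U$ (with $M\ge 1$, $U\ge K$) is a set of $UM>K$ vertices, partitioned into $U$ ''groups'' of cardinality $M$, with a collection of $K$-element subsets called ''blocks'', such that two distinct vertices in the same group lie in no common block, and two vertices in different groups lie in exactly one common block. A $\mathrm{BIBD}(U,K,1)$ is a $K$-GDD of type $1^U$. A transversal design $\mathrm{TD}(K,M)$ is a $K$-GDD of type $M^K$. *)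

(* Defs.v *)
From HB Require Import structures.
From mathcomp Require Import all_boot all_order all_algebra.
From mathcomp Require Import complex reals.

Set Implicit Arguments.
Unset Strict Implicit.
Unset Printing Implicit Defensive.

Import Order.TTheory GRing.Theory Num.Theory.

Local Open Scope ring_scope.

(* [dotmx] is conjugate-linear in its second argument; the definition below
   uses only moduli of inner products, so the convention does not matter. *)
Definition l2norm (C : numClosedFieldType) (D : nat) (u : 'rV[C]_D) : C :=
  sqrtC (dotmx u u).

Definition is_etf (C : numClosedFieldType) (D N : nat) (phi : 'I_N -> 'rV[C]_D)
    : Prop :=
  [/\ forall n, phi n != 0,
      forall n n', l2norm (phi n) = l2norm (phi n'),
      exists c : C, forall n n', n != n' -> `|dotmx (phi n) (phi n')| = c
    & exists2 A : C, 0 < A &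
        forall x : 'rV[C]_D,
          \sum_(n < N) `|dotmx (phi n) x| ^+ 2 = A * l2norm x ^+ 2].

(* K, L, S are rationals constrained to be integers, so that "of type (K, L, S)"
   makes sense, and is false, when S is given by a non-integral quotient.
   Division by zero is total, but K = 0 would give D = 0. *)
Definition is_of_type (D N : nat) (K L S : rat) : Prop :=
  [/\ [/\ K \is a Num.int, S \is a Num.int, 0 < S & L = 1 \/ L = - 1],
      (1 < D < N)%N,
      D%:R = S / K * (S * (K - 1) + L)
    & N%:R = (S + L) * (S * (K - 1) + L)].

Definition etf_of_type_exists (R : realType) (K L S : rat) : Prop :=
  exists (D N : nat) (phi : 'I_N -> 'rV[R[i]]_D),
    is_of_type D N K L S /\ is_etf phi.

(* A set (rather than a multiset) of blocks loses nothing: as K >= 2, the two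
   conditions on pairs of vertices rule out repeated blocks. *)
Definition is_gdd (T : finType) (K M U : nat) (groups blocks : {set {set T}})
    : Prop :=
  [/\ [/\ 2 <= K, 1 <= M, K <= U & K < U * M]%N,
      [/\ #|T| = (U * M)%N, partition groups [set: T]
        & forall G, G \in groups -> #|G| = M],
      forall B, B \in blocks -> #|B| = K,
      forall G x y, G \in groups -> x \in G -> y \in G -> x != y ->
        forall B, B \in blocks -> ~~ ((x \in B) && (y \in B))
    & forall G H x y, G \in groups -> H \in groups -> G != H ->
        x \in G -> y \in H ->
        #|[set B in blocks | (x \in B) && (y \in B)]| = 1%N].

Definition gdd_exists (K M U : nat) : Prop :=
  exists (T : finType) (groups blocks : {set {set T}}),
    is_gdd K M U groups blocks.

Definition bibd1_exists (U K : nat) : Prop := gdd_exists K 1 U.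

Definition td_exists (K M : nat) : Prop := gdd_exists K M K.

(* Main.v *)
Require Import Defs.
From HB Require Import structures.
From mathcomp Require Import all_boot all_order all_algebra.
From mathcomp Require Import complex reals.
From mathcomp Require Import perm cyclic separable finfield cyclotomic.
From mathcomp Require Import ring lra zify.

(** Write M = S(K-1) - 1.  An ETF of type (K,-1,S) consists of (S-1)M vectors
    in dimension SM/K, and counting its frame operator forces the coherence
    1/S ([coherence_of_type]).  Scale it so that distinct vectors have inner
    products of modulus 1; the squared norms become S and the frame constant
    K(S-1).

    Take a K-GDD of type M^U; each vertex lies on R = M(U-1)/(K-1) blocks.
    Sort the old vectors into M classes of S-1 vectors and let the M vertices
    of every group stand for the classes.  If R = (S-1)W, then each pair
    (vertex v, old vector of the class of v) is replaced by W+1 new vectors.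
    Their coordinates are indexed by the blocks and by U copies of the old
    coordinates: in the copy belonging to the group of v stands the old
    vector, and on the R blocks through v stands a row of the tensor product
    of a Fourier matrix of size S-1 and a Fourier matrix of size W+1 from
    which the constant column has been removed.  For two new vectors:
    - if their vertices lie in different groups, only the one common block
      contributes, and all block entries have modulus 1;
    - if their vertices are distinct and in one group, there is no common
      block and the inner product is one of the old frame;
    - if their vertices agree but their old vectors differ, the block parts
      are orthogonal and again an old inner product remains;
    - if both agree, the block parts contribute -(S-1) and the old vector S.
    Columns of Fourier matrices are orthogonal, and the missing constant
    column makes block coordinates orthogonal to the others; both kinds of
    coordinates acquire the frame constant K(S-1)(W+1), so the family is tight
    ([gdd_etf_family]).  Its type is (K,-1,S+R), and
    S + R = (MU+1)/(K-1) ([etf_of_type_gdd]).  The divisibility S-1 | R holds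
    because S-1 divides M once it divides K-2, while K-1 is coprime to M and
    hence divides U-1.

    The GDDs come from two standard operations: giving weight M to the points
    of a BIBD ([has_gdd_weight]), and filling the groups of a transversal
    design with smaller GDDs ([has_gdd_fill]), iterated for U = K^J.

    For the five series one needs a seed and transversal designs TD(K, M K^j)
    for every j.  With no old coordinates and S-1 = 1 the same construction
    turns a BIBD into a Steiner ETF; the triangle and the affine planes of
    order 4, 5 and 8 give the seeds with K = 6, 6, 7, 10.  The seed with
    K = 12 is the set of 64 Hoggar lines in dimension 8.  Most of the
    transversal designs are products of Desarguesian ones; the orders
    54, 324, 384 and 4608 come from truncating one group of a Desarguesian
    design ([has_oa_wilson]), and the orders 24, 35 and 80 from difference
    matrices. *)

Set Implicit Arguments.
Unset Strict Implicit.
Unset Printing Implicit Defensive.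

Import Order.TTheory GRing.Theory Num.Theory.

(** * Group divisible designs and transversal designs *)

(** Groups are the fibres of the first projection, so that the vertex set
    carries a numbering of each group by [P].  Blocks are indexed rather than
    collected in a set, which makes disjoint unions and products of block
    systems immediate. *)
Definition gdd_family (I P X : finType) (k : nat) (blk : X -> {set I * P}) :
    Prop :=
  [/\ forall x, #|blk x| = k,
      forall x v w, v \in blk x -> w \in blk x -> v.1 = w.1 -> v = w,
      forall v w, v.1 != w.1 -> exists x, v \in blk x /\ w \in blk x
    & forall x y v w, v.1 != w.1 -> v \in blk x -> w \in blk x ->
        v \in blk y -> w \in blk y -> x = y].

Definition has_gdd (k : nat) (I P : finType) : Prop :=
  exists (X : finType) (blk : X -> {set I * P}), gdd_family k blk.

Lemma card_eq_bij (A B : finType) :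
  #|A| = #|B| -> exists f : A -> B, bijective f.
Proof.
move=> eqAB; exists (fun x => enum_val (cast_ord eqAB (enum_rank x))).
apply: inj_card_bij; last by rewrite eqAB.
by move=> x y /enum_val_inj/cast_ord_inj/enum_rank_inj.
Qed.

(** Used for designs whose vertices carry no coordinates yet: [h] numbers them. *)
Lemma gdd_comap (T I P X : finType) (k : nat) (h : I * P -> T)
    (blk : X -> {set T}) :
  bijective h -> (forall x, #|blk x| = k) ->
  (forall x v w, h v \in blk x -> h w \in blk x -> v.1 = w.1 -> v = w) ->
  (forall v w, v.1 != w.1 -> exists x, h v \in blk x /\ h w \in blk x) ->
  (forall x y v w, v.1 != w.1 -> h v \in blk x -> h w \in blk x ->
        h v \in blk y -> h w \in blk y -> x = y) ->
  has_gdd k I P.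
Proof.
move=> bh ck h1 h2 h3; exists X, (fun x => h @^-1: blk x); split.
- by move=> x; rewrite on_card_preimset ?ck //; apply: onW_bij.
- by move=> x v w; rewrite !inE; apply: h1.
- by move=> v w /h2[x [vx wx]]; exists x; rewrite !inE.
- by move=> x y v w ne; rewrite !inE; apply: h3.
Qed.

Lemma has_gdd_card (k : nat) (I P I' P' : finType) :
  #|I| = #|I'| -> #|P| = #|P'| -> has_gdd k I P -> has_gdd k I' P'.
Proof.
move=> /esym/card_eq_bij[f [f' fK f'K]] /esym/card_eq_bij[g [g' gK g'K]].
have [injf injg] := (can_inj fK, can_inj gK).
move=> [X [blk [h1 h2 h3 h4]]].
apply: (@gdd_comap _ _ _ _ _ (fun v : I' * P' => (f v.1, g v.2)) blk) => //.
- exists (fun v => (f' v.1, g' v.2)) => -[a b] /=; first by rewrite fK gK.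
  by rewrite f'K g'K.
- move=> x [a b] [c d] vx wx /= eqac.
  by have /= := h2 _ _ _ vx wx; rewrite eqac => /(_ erefl) [] /injg ->.
- by move=> v w ne; apply: h3; rewrite (inj_eq injf).
- by move=> x y v w ne; apply: h4; rewrite (inj_eq injf).
Qed.

(** The numbering of the groups that turns a partition into blocks of equal
    size into the fibres of a projection. *)
Lemma partition_bij (T : finType) (Gs : {set {set T}}) (P : finType) :
  partition Gs [set: T] -> {in Gs, forall G : {set T}, #|G| = #|P|} ->
  exists2 h : {G | G \in Gs} * P -> T, bijective h & forall v, h v \in val v.1.
Proof.
move=> partG cardG.
have card_val (G : {G | G \in Gs}) : #|P| = #|val G| by rewrite cardG ?(valP G).
pose h (v : {G | G \in Gs} * P) : T :=
  enum_val (cast_ord (card_val v.1) (enum_rank v.2)).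
have hG v : h v \in val v.1 by apply: enum_valP.
exists h => //; apply: inj_card_bij; last first.
  rewrite card_prod card_sig -cardsT (card_partition partG).
  rewrite (eq_bigr (fun=> #|P|)) => [|G GGs]; last exact: cardG.
  by rewrite sum_nat_const.
move=> [G p] [G' p'] eqh.
have eqG : G = G'.
  apply: val_inj; have /and3P[_ trivG _] := partG.
  rewrite -(def_pblock trivG (valP G) (hG (G, p))) eqh.
  by rewrite (def_pblock trivG (valP G') (hG (G', p'))).
by move: eqh; rewrite {}eqG => /enum_val_inj/cast_ord_inj/enum_rank_inj /= ->.
Qed.

Lemma gdd_exists_has_gdd (K M U : nat) :
  gdd_exists K M U -> has_gdd K 'I_U 'I_M.
Proof.
move=> [T [Gs [Bs [[K2 M1 _ _] [cardT partG cardG] cardB sameG diffG]]]].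
have cardG' : {in Gs, forall G : {set T}, #|G| = #|'I_M|}.
  by move=> G /cardG ->; rewrite card_ord.
have cardGs : #|{: {G | G \in Gs}}| = U.
  have := card_partition partG; rewrite cardsT cardT (eq_bigr (fun=> M)) //.
  by rewrite sum_nat_const card_sig => /eqP; rewrite eqn_pmul2r // => /eqP <-.
have [h bijh hG] := partition_bij partG cardG'.
have injh := bij_inj bijh.
apply: (@has_gdd_card K {G | G \in Gs} 'I_M); rewrite ?card_ord //.
have uniq_blk v w : v.1 != w.1 ->
    exists2 B, B \in Bs & forall B', B' \in Bs ->
      (h v \in B') && (h w \in B') = (B' == B).
  move=> ne; have /eqP/cards1P[B defB] :=
      diffG _ _ _ _ (valP v.1) (valP w.1) ne (hG v) (hG w).
  exists B => [|B' B'Bs]; first by have := set11 B; rewrite -defB inE => /andP[].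
  by have := in_set1 B' B; rewrite -defB inE B'Bs.
apply: (@gdd_comap T _ _ {B | B \in Bs} K h val) => //.
- by move=> B; apply: cardB (valP B).
- move=> B v w vB wB eqG; apply/eqP/negPn/negP; rewrite -(inj_eq injh) => ne.
  have := sameG _ _ _ (valP v.1) (hG v) _ ne _ (valP B).
  by rewrite eqG hG vB wB => /(_ isT).
- move=> v w /uniq_blk[B BBs BP]; exists (Sub B BBs).
  by apply/andP; rewrite BP ?eqxx.
- move=> B B' v w /uniq_blk[B0 B0Bs BP] vB wB vB' wB'; apply: val_inj.
  have /eqP -> : val B == B0 by rewrite -BP ?vB // (valP B).
  by apply/esym/eqP; rewrite -BP ?vB' // (valP B').
Qed.

(** An orthogonal array of strength two and index one: the rows [f x] are the
    blocks of a transversal design, read as functions on its groups. *)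
Definition is_oa (k : nat) (P X : finType) (f : X -> 'I_k -> P) : Prop :=
  (forall i j a b, i != j -> exists x, f x i = a /\ f x j = b) /\
  (forall i j x y, i != j -> f x i = f y i -> f x j = f y j -> x = y).

Definition has_oa (k : nat) (P : finType) : Prop :=
  exists (X : finType) (f : X -> 'I_k -> P), is_oa f.

(** A block of size [k] meets each of the [k] groups in at most one point, hence
    in exactly one. *)
Lemma has_gdd_oa (k : nat) (P : finType) : has_gdd k 'I_k P -> has_oa k P.
Proof.
move=> [X [blk [cardB sameG exB uniqB]]].
have fst_inj x : {in blk x &, injective fst}.
  by move=> v w vx wx; apply: sameG vx wx.
have point_ex x i : exists p, (i, p) \in blk x.
  have : i \in [set v.1 | v in blk x].
    suff -> : [set v.1 | v in blk x] = setT by rewrite inE.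
    by apply/eqP; rewrite eqEcard subsetT cardsT card_ord card_in_imset ?cardB //=.
  by case/imsetP=> -[j p] jp -> /=; exists p.
pose f x i := xchoose (point_ex x i).
have fP x i p : (i, p) \in blk x -> f x i = p.
  by move=> ip; have [] := sameG _ _ _ (xchooseP (point_ex x i)) ip erefl.
have fI x i : (i, f x i) \in blk x := xchooseP (point_ex x i).
exists X, f; split=> [i j a b ne | i j x y ne eqi eqj].
  by have [x [/fP <- /fP <-]] := exB (i, a) (j, b) ne; exists x.
by apply: (uniqB x y (i, f x i) (j, f x j) ne); rewrite // ?eqi ?eqj.
Qed.

(** Blocks through a vertex, and points on a block, have to be numbered by a
    prescribed index type; any bijection serves. *)
Lemma ex_labelling (T B : finType) (A : {set T}) :
  0 < #|B| -> #|A| = #|B| ->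
  exists2 r : T -> B, {in A &, injective r} & [set r x | x in A] = setT.
Proof.
move=> B0 cardAB; have [b0 _] := card_gt0P B0.
have ltB x : x \in A -> index x (enum A) < size (enum B).
  by move=> xA; rewrite -cardE -cardAB cardE index_mem mem_enum.
pose r x := nth b0 (enum B) (index x (enum A)).
have injr : {in A &, injective r}.
  move=> x y xA yA /eqP; rewrite nth_uniq ?enum_uniq ?ltB // => /eqP eqi.
  rewrite -(@nth_index _ x x (enum A)) ?mem_enum // eqi.
  by rewrite nth_index ?mem_enum.
exists r => //; apply/eqP; rewrite eqEcard subsetT cardsT.
by rewrite card_in_imset //= cardAB.
Qed.

(** Wilson's weighting with constant weight: every vertex is replaced by a copy
    of [P] and every block by a transversal design on the copies of its points.
    Two points over distinct vertices of different groups lie over one block,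
    and then on one block of the transversal design. *)
Lemma has_gdd_weight (k : nat) (I Q P : finType) :
  0 < k -> has_gdd k I Q -> has_oa k P -> has_gdd k I (Q * P)%type.
Proof.
move=> k0 [X [blk [cardB sameG exB uniqB]]] [Y [f [exY uniqY]]].
have lab_ex x : exists2 r : I * Q -> 'I_k, {in blk x &, injective r} &
    [set r v | v in blk x] = setT by apply: ex_labelling; rewrite ?cardB card_ord.
have /fin_all_exists2[r injr _] := lab_ex.
pose old (v : I * (Q * P)) : I * Q := (v.1, v.2.1).
pose blk' (xy : X * Y) : {set I * (Q * P)} :=
  [set v | (old v \in blk xy.1) && (f xy.2 (r xy.1 (old v)) == v.2.2)].
have blkE x y v : (v \in blk' (x, y)) =
    (old v \in blk x) && (f y (r x (old v)) == v.2.2) by rewrite inE.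
have rank_neq x v w : v.1 != w.1 -> old v \in blk x -> old w \in blk x ->
    r x (old v) != r x (old w).
  by move=> ne vx wx; apply: contra ne => /eqP/(injr x _ _ vx wx)[-> _].
exists (X * Y)%type, blk'; split.
- move=> [x y]; rewrite -[RHS](cardB x) -(@card_in_imset _ _ old) => [|v w].
    apply: eq_card => -[i q]; apply/imsetP/idP => [[v] | iqx].
      by rewrite blkE => /andP[vx _] ->.
    exists (i, (q, f y (r x (i, q)))) => //.
    by rewrite blkE iqx eqxx.
  rewrite !blkE => /andP[_ /eqP vp] /andP[_ /eqP wp] eqvw.
  move: vp wp; rewrite eqvw => ->; case: v w eqvw => [i [q p]] [i' [q' p']] /=.
  by case=> -> -> ->.
- move=> [x y] v w; rewrite !blkE => /andP[vx /eqP vp] /andP[wx /eqP wp] eq1.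
  have eqvw := sameG _ _ _ vx wx eq1.
  move: vp wp; rewrite eqvw => ->.
  case: v w eqvw {vx wx eq1} => [i [q p]] [i' [q' p']] /=.
  by case=> -> -> ->.
- move=> v w ne; have [x [vx wx]] := exB (old v) (old w) ne.
  have [y [yv yw]] := exY _ _ v.2.2 w.2.2 (rank_neq x v w ne vx wx).
  by exists (x, y); rewrite !blkE vx wx yv yw !eqxx.
- move=> [x y] [x' y'] v w ne; rewrite !blkE.
  move=> /andP[vx /eqP vp] /andP[wx /eqP wp] /andP[vx' /eqP vp'] /andP[wx' /eqP wp'].
  have eqx : x = x' by apply: (uniqB _ _ (old v) (old w)).
  rewrite -{x'}eqx in vx' wx' vp' wp' *.
  by rewrite (uniqY _ _ _ _ (rank_neq x v w ne vx wx)
                (etrans vp (esym vp')) (etrans wp (esym wp'))).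
Qed.

(** Filling in groups: a pair of points from one group [Q * P] is covered by the
    small design put on that group exactly when it is not already in a common
    group of the small design. *)
Lemma has_gdd_fill (k : nat) (I Q P : finType) :
  has_gdd k I (Q * P)%type -> has_gdd k Q P -> has_gdd k (I * Q)%type P.
Proof.
move=> [X [blk [cardB sameG exB uniqB]]] [Y [blk1 [cardB1 sameG1 exB1 uniqB1]]].
pose re (v : I * Q * P) : I * (Q * P) := (v.1.1, (v.1.2, v.2)).
pose er (v : I * (Q * P)) : I * Q * P := (v.1, v.2.1, v.2.2).
have reK : cancel re er by case=> [[i q] p].
have erK : cancel er re by case=> [i [q p]].
pose blk' (z : X + I * Y) : {set I * Q * P} :=
  match z with
  | inl x => re @^-1: blk x
  | inr (i, y) => [set v | (v.1.1 == i) && ((v.1.2, v.2) \in blk1 y)]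
  end.
have blkl x v : (v \in blk' (inl x)) = (re v \in blk x) by rewrite inE.
have blkr i y v : (v \in blk' (inr (i, y))) = (v.1.1 == i) && ((v.1.2, v.2) \in blk1 y).
  by rewrite inE.
exists (X + I * Y)%type, blk'; split.
- case=> [x | [i y]].
    by rewrite on_card_preimset ?cardB //; apply/onW_bij; exists er.
  rewrite -(cardB1 y) -(@card_in_imset _ _ (fun v => (v.1.2, v.2))).
    apply: eq_card => -[q p]; apply/imsetP/idP => [[v] | qpy].
      by rewrite blkr => /andP[_ vy] ->.
    by exists (i, q, p); rewrite ?blkr ?eqxx.
  move=> [[i1 q1] p1] [[i2 q2] p2]; rewrite !blkr /=.
  by move=> /andP[/eqP-> _] /andP[/eqP-> _] [-> ->].
- case=> [x | [i y]] v w.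
    rewrite !blkl => vx wx eq1; apply: (can_inj reK); apply: sameG vx wx _.
    by rewrite /= eq1.
  rewrite !blkr => /andP[/eqP i1 vy] /andP[/eqP i2 wy] eq1.
  have := sameG1 _ _ _ vy wy; rewrite /= eq1 => /(_ erefl)[].
  by case: v w eq1 {i1 i2 vy wy} => [a b] [c d] /= -> ->.
- move=> v w ne; have [eq1 | ne1] := eqVneq v.1.1 w.1.1.
    have ne2 : v.1.2 != w.1.2.
      by apply: contra ne => /eqP eq2; rewrite -pair_eqE /= /pair_eq eq1 eq2 !eqxx.
    have [y [vy wy]] := exB1 (v.1.2, v.2) (w.1.2, w.2) ne2.
    by exists (inr (v.1.1, y)); rewrite !blkr vy wy eq1 !eqxx.
  by have [x [vx wx]] := exB (re v) (re w) ne1; exists (inl x); rewrite !blkl.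
- move=> z z' v w ne.
  have ne2 : v.1.1 = w.1.1 -> v.1.2 != w.1.2.
    move=> eq1; apply: contra ne => /eqP eq2.
    by rewrite -pair_eqE /= /pair_eq eq1 eq2 !eqxx.
  have ne1 x : re v \in blk x -> re w \in blk x -> v.1.1 != w.1.1.
    move=> vx wx; apply/negP => /eqP eq1.
    have /(can_inj reK) eqvw := sameG _ _ _ vx wx eq1.
    by have := ne; rewrite eqvw eqxx.
  case: z z' => [x | [i y]] [x' | [i' y']]; rewrite ?blkl ?blkr.
  + move=> vx wx vx' wx'; congr inl.
    exact: (uniqB _ _ (re v) (re w) (ne1 _ vx wx) vx wx vx' wx').
  + move=> vx wx /andP[/eqP vi _] /andP[/eqP wi _].
    by have := ne1 _ vx wx; rewrite vi wi eqxx.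
  + move=> /andP[/eqP vi _] /andP[/eqP wi _] vx wx.
    by have := ne1 _ vx wx; rewrite vi wi eqxx.
  + move=> /andP[/eqP vi vy] /andP[/eqP wi wy] /andP[/eqP vi' vy'] /andP[/eqP wi' wy'].
    rewrite -vi -vi'; congr (inr (_, _)).
    by apply: (uniqB1 _ _ (v.1.2, v.2) (w.1.2, w.2) (ne2 _) vy wy vy' wy'); rewrite vi wi.
Qed.

Lemma has_gdd_of_oa (k : nat) (P : finType) : has_oa k P -> has_gdd k 'I_k P.
Proof.
move=> [X [f [exX uniqX]]]; exists X, (fun x => [set v | f x v.1 == v.2]); split.
- move=> x; rewrite -[RHS]card_ord -cardsT -(@card_in_imset _ _ fst).
    apply: eq_card => i; rewrite in_setT; apply/imsetP.
    by exists (i, f x i); rewrite ?inE.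
  by move=> [i p] [j q]; rewrite !inE /= => /eqP <- /eqP <- ->.
- by move=> x [i p] [j q]; rewrite !inE /= => /eqP <- /eqP <- ->.
- move=> v w ne; have [x [xv xw]] := exX _ _ v.2 w.2 ne.
  by exists x; rewrite !inE xv xw.
- move=> x y v w ne; rewrite !inE => /eqP xv /eqP xw /eqP yv /eqP yw.
  by apply: (uniqX _ _ _ _ ne); rewrite ?xv ?yv ?xw ?yw.
Qed.

(** Induction on [J]: the groups of a design of type (k^J |P|)^k are filled with
    the design of type |P|^(k^J). *)
Lemma has_gdd_power (k J : nat) (P : finType) :
  0 < J -> (forall j, j < J -> has_gdd k 'I_k ('I_(k ^ j) * P)%type) ->
  has_gdd k 'I_(k ^ J) P.
Proof.
case: J => // J _; elim: J => [|J IH] tds.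
  apply: has_gdd_card (tds 0 isT); first by rewrite !card_ord.
  by rewrite card_prod card_ord mul1n.
have := has_gdd_fill (tds J.+1 (leqnn _)) (IH (fun j jJ => tds j (ltnW jJ))).
by apply: has_gdd_card => //; rewrite card_prod !card_ord -expnS.
Qed.

(** * Orthogonal arrays and difference matrices *)

Lemma has_oa_card (k : nat) (P P' : finType) :
  #|P| = #|P'| -> has_oa k P -> has_oa k P'.
Proof.
move=> /card_eq_bij[g [g' gK g'K]] [X [f [exf uniqf]]].
exists X, (fun x i => g (f x i)); split=> [i j a b ne | i j x y ne].
  by have [x [xi xj]] := exf i j (g' a) (g' b) ne; exists x; rewrite xi xj !g'K.
by move=> /(can_inj gK) eqi /(can_inj gK) eqj; apply: uniqf ne eqi eqj.
Qed.

Lemma has_oa_rows (k k' : nat) (P : finType) :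
  k <= k' -> has_oa k' P -> has_oa k P.
Proof.
move=> kk' [X [f [exf uniqf]]].
have neq_widen i j : i != j -> widen_ord kk' i != widen_ord kk' j by [].
exists X, (fun x i => f x (widen_ord kk' i)); split.
  by move=> i j a b /neq_widen; apply: exf.
by move=> i j x y /neq_widen; apply: uniqf.
Qed.

Lemma has_oa_prod (k : nat) (P Q : finType) :
  has_oa k P -> has_oa k Q -> has_oa k (P * Q)%type.
Proof.
move=> [X [f [exf uniqf]]] [Y [g [exg uniqg]]].
exists (X * Y)%type, (fun xy i => (f xy.1 i, g xy.2 i)).
split=> [i j [a a'] [b b'] ne | i j [x x'] [y y'] ne [xi yi] [xj yj]].
  have [x [<- <-]] := exf i j a b ne; have [y [<- <-]] := exg i j a' b' ne.
  by exists (x, y).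
by rewrite (uniqf _ _ _ _ ne xi xj) (uniqg _ _ _ _ ne yi yj).
Qed.

(** Uniqueness of the row with two prescribed entries suffices when the number
    of rows is right, since an injection between finite sets of the same size
    is onto. *)
Lemma has_oa_inj (k : nat) (P X : finType) (f : X -> 'I_k -> P) :
  #|X| = #|P| * #|P| ->
  (forall i j x y, i != j -> f x i = f y i -> f x j = f y j -> x = y) ->
  has_oa k P.
Proof.
move=> cardX injf; exists X, f; split=> // i j a b ne.
have [h _ hK] : bijective (fun x => (f x i, f x j)).
  apply: inj_card_bij => [x y [xi xj]|]; first exact: injf ne xi xj.
  by rewrite card_prod cardX.
by exists (h (a, b)); case: (hK (a, b)).
Qed.

(** The affine plane over [F]: the line of slope [a] and intercept [b] takes the
    value [a m + b] at [m], and the last coordinate, at infinity, is its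
    slope. *)
Lemma has_oa_field (F : finFieldType) : has_oa #|F|.+1 F.
Proof.
have cardoF : #|'I_#|F|.+1| = #|{: option F}| by rewrite card_ord card_option.
have [c /bij_inj injc] := card_eq_bij cardoF.
pose f (ab : F * F) (i : 'I_#|F|.+1) : F :=
  if c i is Some m then (ab.1 * m + ab.2)%R else ab.1.
apply: (@has_oa_inj _ F _ f); first by rewrite card_prod.
move=> i j [a b] [a' b'] ne; rewrite /f /=.
have: c i != c j by rewrite (inj_eq injc).
case: (c i) (c j) => [m|] [m'|] //= ne_m.
- move=> eqm eqm'; suff eqa : a = a' by move: eqm; rewrite eqa => /addrI ->.
  have /eqP : ((a - a') * (m - m') = 0)%R.
    have -> : ((a - a') * (m - m') =
        a * m + b - (a * m' + b) - (a' * m + b') + (a' * m' + b'))%R.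
      by ring.
    by rewrite eqm eqm'; ring.
  rewrite mulf_eq0 !subr_eq0 => /orP[/eqP // | /eqP eqmm].
  by rewrite eqmm eqxx in ne_m.
- by move=> + eqa; rewrite eqa => /addrI ->.
- by move=> ->  /addrI ->.
Qed.

Lemma has_oa_prime_power (p e k : nat) :
  prime p -> 0 < e -> k <= p ^ e + 1 -> has_oa k 'I_(p ^ e).
Proof.
move=> pr e0; rewrite addn1 => ke.
have [F _ cardF] := PrimePowerField pr e0.
apply: (has_oa_rows ke); apply: (@has_oa_card _ F); first by rewrite cardF card_ord.
by rewrite -cardF; apply: has_oa_field.
Qed.

Lemma has_oa_mul (k m n : nat) :
  has_oa k 'I_m -> has_oa k 'I_n -> has_oa k 'I_(m * n).
Proof.
by move=> hm hn; apply: has_oa_card (has_oa_prod hm hn); rewrite card_prod !card_ord.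
Qed.

(** Wilson's construction.  In a transversal design with [k + 1] groups all
    points of the last group outside [A] are deleted, and every point of the
    other groups is replaced by a copy of [M].  A block missing [A] becomes a
    design with groups [M]; a block meeting [A] in [u] becomes a design with
    groups [option M], where [None] in each group stands for the copy of [u]
    there.  The block of that design consisting of the points [None] is
    dropped, and the pairs it covered are covered by a design on [A]. *)
Lemma has_oa_wilson (k : nat) (M T : finType) (A : {set T}) :
  has_oa k M -> has_oa k (option M) -> has_oa k.+1 T ->
  has_oa k {x | x \in A} -> has_oa k (T * M + {x | x \in A})%type.
Proof.
have [k_le1|k_gt1] := leqP k 1.
  (* Without two distinct groups the empty array satisfies all conditions. *)
  move=> _ _ _ _; have noneq (i j : 'I_k) : i != j -> False.
    by case: k k_le1 i j => [|[|//]] _ i j; [case: i | rewrite !ord1].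
  by exists void, (fun x : void => match x with end); split=> [i j a b /noneq | i j []].
move=> [Xm [fm [exm uniqm]]] [Z [h0 [exh0 uniqh0]]] [Y [g [exg uniqg]]].
move=> [Xu [fu [exu uniqu]]].
have [z0 _] := exh0 (Ordinal (ltnW k_gt1)) (Ordinal k_gt1) None None isT.
(* Relabelling the symbols of each group moves some block [z0] to the points
   [None]. *)
pose h z i := tperm (h0 z0 i) None (h0 z i).
have hz0 i : h z0 i = None by rewrite /h tpermL.
have exh i j a b : i != j -> exists z, h z i = a /\ h z j = b.
  move=> ne.
  have [z [zi zj]] := exh0 i j (tperm (h0 z0 i) None a) (tperm (h0 z0 j) None b) ne.
  by exists z; rewrite /h zi zj !tpermK.
have uniqh i j y z : i != j -> h y i = h z i -> h y j = h z j -> y = z.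
  by move=> ne /perm_inj eqi /perm_inj eqj; apply: uniqh0 ne eqi eqj.
pose l y := g y ord_max.
pose w (i : 'I_k) := widen_ord (leqnSn k) i.
have w_neq i j : i != j -> w i != w j by [].
have w_max i : w i != ord_max by rewrite -(inj_eq val_inj) /= neq_ltn ltn_ord.
pose X1 := {yx : Y * Xm | l yx.1 \notin A}.
pose X2 := {yz : Y * Z | (l yz.1 \in A) && (yz.2 != z0)}.
pose line2 (p : X2) i : T * M + {x | x \in A} :=
  if h (val p).2 i is Some m then inl (g (val p).1 (w i), m)
  else inr (Sub (l (val p).1) (proj1 (andP (valP p)))).
pose f (x : X1 + X2 + Xu) i : T * M + {x | x \in A} :=
  match x with
  | inl (inl p) => inl (g (val p).1 (w i), fm (val p).2 i)
  | inl (inr p) => line2 p i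
  | inr x => inr (fu x i)
  end.
have line2P y z lyA i : f (inl (inr (Sub (y, z) lyA))) i =
    if h z i is Some m then inl (g y (w i), m) else inr (Sub (l y) (proj1 (andP lyA))).
  rewrite /f /line2 /=; case: (h z i) => // ; congr inr; exact: val_inj.
have mixed i j t m (u : {x | x \in A}) : i != j ->
    exists x, f x i = inl (t, m) /\ f x j = inr u.
  move=> ne; have [y [yi yl]] := exg (w i) ord_max t (val u) (w_max i).
  have lyA : l y \in A by rewrite /l yl (valP u).
  have [z [zi zj]] := exh i j (Some m) None ne.
  have lyzA : (l y \in A) && (z != z0).
    by rewrite lyA; apply: contra_eqN zi => /eqP ->; rewrite hz0.
  exists (inl (inr (Sub (y, z) lyzA))); rewrite !line2P zi zj yi; split=> //.
  by congr inr; apply: val_inj; rewrite /= -yl.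
exists (X1 + X2 + Xu)%type, f; split.
  move=> i j [[t m]|u] [[t' m']|u'] ne.
  - have [y [yi yj]] := exg (w i) (w j) t t' (w_neq i j ne).
    have [lyA | lyA] := boolP (l y \in A); last first.
      have [x [xi xj]] := exm i j m m' ne.
      by exists (inl (inl (Sub (y, x) lyA))); rewrite /f /= xi xj yi yj.
    have [z [zi zj]] := exh i j (Some m) (Some m') ne.
    have lyzA : (l y \in A) && (z != z0).
      by rewrite lyA; apply: contra_eqN zi => /eqP ->; rewrite hz0.
    by exists (inl (inr (Sub (y, z) lyzA))); rewrite !line2P zi zj yi yj.
  - exact: mixed.
  - rewrite eq_sym in ne.
    by have [x [xj xi]] := mixed j i t' m' u ne; exists x.
  - have [x [xi xj]] := exu i j u u' ne.
    by exists (inr x); rewrite /f xi xj.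
have line2_ne (p : X2) i j :
    i != j -> h (val p).2 i = None -> h (val p).2 j = None -> False.
  move=> ne hi hj; have /andP[_ /eqP[]] := valP p.
  by apply: (uniqh _ _ _ _ ne); rewrite hz0.
move=> i j x y ne.
case: x y => [[p | p] | x] [[q | q] | y]; rewrite /f /line2 //.
- move=> [gi fi] [gj fj]; congr (inl (inl _)); apply: val_inj.
  rewrite [val p]surjective_pairing [val q]surjective_pairing.
  by rewrite (uniqg _ _ _ _ (w_neq _ _ ne) gi gj) (uniqm _ _ _ _ ne fi fj).
- case: (h _ i) => // m [gi _]; case: (h _ j) => // m' [gj _].
  have := valP p; have /andP[] := valP q.
  by rewrite (uniqg _ _ _ _ (w_neq _ _ ne) gi gj) => ->.
- case: (h _ i) => // m [gi _]; case: (h _ j) => // m' [gj _].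
  have := valP q; have /andP[] := valP p.
  by rewrite (uniqg _ _ _ _ (w_neq _ _ ne) gi gj) => ->.
- have eqpq : (val p).1 = (val q).1 -> h (val p).2 i = h (val q).2 i ->
      h (val p).2 j = h (val q).2 j -> inl (inr p) = inl (inr q) :> X1 + X2 + Xu.
    move=> eq1 hi hj; congr (inl (inr _)); apply: val_inj.
    rewrite [val p]surjective_pairing [val q]surjective_pairing eq1.
    by rewrite (uniqh _ _ _ _ ne hi hj).
  case Epi: (h (val p).2 i) => [m|]; case Eqi: (h (val q).2 i) => [m'|] // eqi;
  case Epj: (h (val p).2 j) => [n|]; case Eqj: (h (val q).2 j) => [n'|] // eqj.
  + case: eqi eqj => gi mi [gj mj].
    apply: eqpq; rewrite ?Epi ?Eqi ?Epj ?Eqj ?mi ?mj //.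
    exact: (uniqg _ _ _ _ (w_neq _ _ ne) gi gj).
  + case: eqi eqj => gi mi [lj].
    apply: eqpq; rewrite ?Epi ?Eqi ?Epj ?Eqj ?mi //.
    exact: (uniqg _ _ _ _ (w_max i) gi lj).
  + case: eqi eqj => li [gj mj].
    apply: eqpq; rewrite ?Epi ?Eqi ?Epj ?Eqj ?mj //.
    exact: (uniqg _ _ _ _ (w_max j) gj li).
  + by case: (line2_ne _ _ _ ne Epi Epj).
- by case Ei: (h _ i) => //; case Ej: (h _ j) => //; case: (line2_ne _ _ _ ne Ei Ej).
- by case Ei: (h _ i) => //; case Ej: (h _ j) => //; case: (line2_ne _ _ _ ne Ei Ej).
- by move=> [xi] [xj]; congr inr; apply: (uniqu _ _ _ _ ne).
Qed.

Lemma has_oa_wilson_ord (k m t u : nat) :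
  u <= t -> has_oa k 'I_m -> has_oa k 'I_m.+1 -> has_oa k.+1 'I_t -> has_oa k 'I_u ->
  has_oa k 'I_(m * t + u).
Proof.
move=> ut om om1 ot ou; pose A := [set x : 'I_t | x < u].
have cardA : #|{: {x | x \in A}}| = u.
  rewrite card_sig -[RHS]card_ord -(card_codom (f := widen_ord ut)); last first.
    by move=> x y eqxy; apply: val_inj; apply: (congr1 val eqxy).
  apply: eq_card => x; rewrite !inE.
  apply/idP/codomP => [xu | [y ->]]; last exact: ltn_ord y.
  by exists (Ordinal xu); apply: val_inj.
have : has_oa k ('I_t * 'I_m + {x | x \in A})%type.
  apply: has_oa_wilson => //.
    by apply: has_oa_card om1; rewrite card_option !card_ord.
  by apply: has_oa_card ou; rewrite cardA card_ord.
by apply: has_oa_card; rewrite card_sum card_prod cardA !card_ord mulnC.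
Qed.

(** Developing a difference matrix over the group [V]: the translates of its
    columns are the rows of an array, and the column number is one more
    coordinate.  [P] is [V] regarded as a finite set. *)
Lemma has_oa_diff (k : nat) (P : finType) (V : zmodType) (h : P -> V)
    (D : 'I_k -> P -> V) :
  bijective h -> (forall i j, i != j -> injective (fun c => D i c - D j c)%R) ->
  has_oa k.+1 P.
Proof.
move=> [h' hK h'K] injD.
pose f (gc : P * P) (i : 'I_k.+1) :=
  if unlift ord_max i is Some j then h' (D j gc.2 + h gc.1)%R else gc.2.
apply: (@has_oa_inj _ P _ f); first by rewrite card_prod.
move=> i j [g c] [g' c']; rewrite /f /=.
case: unliftP => [i'|] ->; case: unliftP => [j'|] -> ne /=.
- move=> /(can_inj h'K) eqi /(can_inj h'K) eqj; have eqc : c = c'.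
    apply: (injD i' j'); first by rewrite -(inj_eq (lift_inj (h := ord_max))).
    rewrite /=; have -> : (D i' c - D j' c = (D i' c + h g) - (D j' c + h g))%R.
      by rewrite opprD addrACA subrr addr0.
    by rewrite eqi eqj opprD addrACA subrr addr0.
  by move: eqi; rewrite eqc => /addrI/(can_inj hK) ->.
- by move=> + eqc; rewrite eqc => /(can_inj h'K)/addrI/(can_inj hK) ->.
- by move=> -> /(can_inj h'K)/addrI/(can_inj hK) ->.
- by rewrite eqxx in ne.
Qed.

Definition is_diff_table (G : zmodType) (k n : nat) (D : nat -> nat -> G) : bool :=
  all (fun i => all (fun j => (i == j) ||
    uniq [seq (D i c - D j c)%R | c <- iota 0 n]) (iota 0 k)) (iota 0 k).

Lemma has_oa_diff_table (k n : nat) (P : finType) (V : zmodType) (h : P -> V)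
    (D : nat -> nat -> V) :
  bijective h -> #|P| = n -> is_diff_table k n D -> has_oa k.+1 'I_n.
Proof.
move=> bij_h <- /allP tabD; apply: (@has_oa_card _ P); first by rewrite card_ord.
apply: (@has_oa_diff _ _ _ h (fun i c => D i (enum_rank c)) bij_h) => i j ne.
have mem_k (x : 'I_k) : val x \in iota 0 k by rewrite mem_iota ltn_ord.
have /allP/(_ _ (mem_k j)) := tabD _ (mem_k i).
rewrite (inj_eq val_inj) (negPf ne) /= => uniqD c c' eqD.
apply: enum_rank_inj; apply: val_inj; apply/eqP.
rewrite -(nth_uniq 0%R _ _ uniqD) ?size_map ?size_iota ?ltn_ord //.
by rewrite !(nth_map 0) ?size_iota ?ltn_ord // !nth_iota ?ltn_ord // !add0n eqD.
Qed.

Definition lookup (tab : seq (seq nat)) i j := nth 0 (nth [::] tab i) j.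

(** The doubling construction of Abel and Cheng.  [B] is a difference matrix of
    index two over [Z/g], with [2g] columns.  Over [Z/g x GF(2^(c+1))] take the
    entries [(B_is, C_is + Y_i v)] for [v] in a hyperplane [H] of the field.
    The two columns [s] with the same difference [B_is - B_js] then give two
    cosets of [(Y_i - Y_j) H], and [C] is chosen so that the cosets differ.
    A column number [n] encodes [s] by its upper digits and the coordinates of
    [v] in a basis of [H] by its [c] lowest bits; row [i] of [L] lists the
    products of [Y_i] with that basis.  Elements of the field are
    written as numbers whose binary digits [bits] extracts. *)
Definition lift_table (E : zmodType) (bits : nat -> E) (g c : nat)
    (B C L : seq (seq nat)) (i n : nat) : 'Z_g * E :=
  let s := n %/ 2 ^ c in
  (inZp (lookup B i s),
   foldr (fun e x => (if odd (n %/ 2 ^ e) then bits (lookup L i e) else 0) + x)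
     (bits (lookup C i s)) (iota 0 c))%R.

Definition bit (n e : nat) : 'Z_2 := inZp (n %/ 2 ^ e).

(** The matrices [B24] and [B80] are five rows of a generalised Hadamard matrix
    of order 6 over [Z/3] and nine rows of one of order 10 over [Z/5].  The
    conditions on [C] are linear over GF(2) once [B] and [Y] are fixed, and
    [C24] and [C80] are solutions of these linear systems.  The fields are
    GF(2)[x]/(x^3 + x + 1) with [Y] = 0, 4, 1, 6, 7, and
    GF(2)[x]/(x^4 + x + 1) with [Y] = 0, 6, 5, 12, 2, 13, 15, 8, 14; the
    hyperplanes consist of the elements of trace zero. *)
Definition B24 := [:: [:: 0; 0; 0; 0; 0; 0]; [:: 0; 1; 2; 1; 2; 0]; [:: 0; 2; 1; 1; 0; 2];
  [:: 0; 2; 2; 0; 1; 1]; [:: 0; 0; 1; 2; 2; 1]].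
Definition C24 := [:: [:: 0; 0; 0; 0; 0; 0]; [:: 0; 0; 0; 4; 4; 4]; [:: 0; 0; 0; 1; 1; 1];
  [:: 0; 2; 6; 4; 1; 7]; [:: 0; 2; 6; 5; 6; 0]].
Definition L24 := [:: [:: 0; 0]; [:: 3; 6]; [:: 2; 4]; [:: 7; 5]; [:: 5; 1]].

Lemma has_oa_24 : has_oa 6 'I_24.
Proof.
pose bits n := (bit n 0, bit n 1, bit n 2).
apply: (@has_oa_diff_table _ _ ('Z_3 * ('Z_2 * 'Z_2 * 'Z_2))%type _ id
  (lift_table bits 3 2 B24 C24 L24)); first by exists id.
  by rewrite !card_prod !card_ord.
by vm_compute.
Qed.

Definition B80 := [::
  [:: 0; 0; 0; 0; 0; 0; 0; 0; 0; 0]; [:: 0; 1; 2; 3; 4; 4; 0; 1; 2; 3];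
  [:: 0; 2; 4; 1; 3; 1; 3; 0; 2; 4]; [:: 0; 3; 1; 4; 2; 1; 4; 2; 0; 3];
  [:: 0; 4; 3; 2; 1; 4; 3; 2; 1; 0]; [:: 0; 4; 1; 1; 4; 0; 2; 3; 3; 2];
  [:: 0; 0; 3; 4; 3; 2; 2; 1; 4; 1]; [:: 0; 1; 0; 2; 2; 3; 1; 3; 4; 4];
  [:: 0; 2; 2; 0; 1; 3; 4; 4; 3; 1]].
Definition C80 := [::
  [:: 0; 0; 0; 0; 0; 0; 0; 0; 0; 0]; [:: 0; 0; 0; 0; 0; 8; 8; 8; 8; 8];
  [:: 0; 0; 0; 0; 0; 12; 12; 12; 12; 12]; [:: 0; 0; 0; 0; 0; 10; 10; 10; 10; 3];
  [:: 0; 0; 0; 0; 0; 1; 1; 1; 1; 9]; [:: 0; 8; 12; 10; 2; 2; 8; 10; 4; 6];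
  [:: 0; 8; 10; 4; 6; 1; 13; 7; 3; 15]; [:: 0; 8; 10; 1; 14; 13; 15; 4; 14; 7];
  [:: 0; 2; 7; 6; 15; 9; 13; 6; 0; 4]].
Definition L80 := [:: [:: 0; 0; 0]; [:: 6; 12; 11]; [:: 5; 10; 7]; [:: 12; 11; 5];
  [:: 2; 4; 8]; [:: 13; 9; 1]; [:: 15; 13; 9]; [:: 8; 3; 6]; [:: 14; 15; 13]].

Lemma has_oa_80 : has_oa 10 'I_80.
Proof.
pose bits n := (bit n 0, bit n 1, bit n 2, bit n 3).
apply: (@has_oa_diff_table _ _ ('Z_5 * ('Z_2 * 'Z_2 * 'Z_2 * 'Z_2))%type _ id
  (lift_table bits 5 3 B80 C80 L80)); first by exists id.
  by rewrite !card_prod !card_ord.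
by vm_compute.
Qed.

Definition scale35 (m : nat) (v : seq nat) := [seq m * x %% 35 | x <- v].
Definition turn35 (v : seq nat) :=
  scale35 11 (rotr 1 (take 3 v) ++ rotr 1 (drop 3 v)).
Definition pm35 (v : seq nat) := [:: v; scale35 34 v].

(** A difference matrix with six rows over [Z/35], given by representatives of
    the orbits of its columns under two symmetries: the sign change, and
    [turn35], which rotates the first three and the last three rows and
    multiplies by 11, a cube root of unity modulo 35.  The zero column is fixed
    by both and the next two columns are fixed by [turn35], so that
    1 + 2 * 2 + 5 * 6 = 35 columns arise.  Differences then need to be compared
    for five pairs of rows up to sign, which brings such a matrix within reach of a
    computer search. *)
Definition columns35 : seq (seq nat) :=
  nseq 6 0 ::
  flatten [seq pm35 v | v <- [:: [:: 15; 25; 30; 13; 3; 33]; [:: 5; 20; 10; 9; 29; 4]]] ++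
  flatten [seq pm35 v ++ pm35 (turn35 v) ++ pm35 (turn35 (turn35 v)) | v <- [::
    [:: 0; 1; 22; 7; 33; 21]; [:: 0; 2; 10; 34; 3; 27]; [:: 0; 4; 8; 20; 18; 33];
    [:: 0; 7; 4; 32; 13; 31]; [:: 0; 8; 24; 10; 4; 12]]].

Lemma has_oa_35 : has_oa 7 'I_35.
Proof.
apply: (@has_oa_diff_table 6 35 'Z_35 'Z_35 id (fun i n => inZp (lookup columns35 n i))).
- by exists id.
- by rewrite card_ord.
by vm_compute.
Qed.

(** * Orders of transversal designs in the five series *)

Lemma has_oa_prime (p k : nat) : prime p -> k <= p.+1 -> has_oa k 'I_p.
Proof.
move=> pr_p le_k; have := @has_oa_prime_power p 1 k pr_p isT.
by rewrite expn1 addn1; apply.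
Qed.

(** MacNeish's bound for two prime powers. *)
Lemma has_oa_two_primes (k p q a b : nat) :
  prime p -> prime q -> 0 < a -> 0 < b -> k <= p ^ a + 1 -> k <= q ^ b + 1 ->
  has_oa k 'I_(p ^ a * q ^ b).
Proof. by move=> pp pq a0 b0 ka kb; apply: has_oa_mul; apply: has_oa_prime_power. Qed.

Lemma leq_exp_add1 (k p a b : nat) : 0 < p -> a <= b -> k <= p ^ a + 1 -> k <= p ^ b + 1.
Proof.
by move=> p0 ab /leq_trans; apply; rewrite leq_add2r leq_pexp2l.
Qed.

(** The prime power parts of [9 * 6 ^ j] are large enough from [j = 3] on; below,
    [54 = 7 * 7 + 5] and [324 = 7 * 41 + 37]. *)
Lemma has_oa_9_6 (j : nat) : has_oa 6 'I_(9 * 6 ^ j).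
Proof.
have [|j3] := ltnP j 3; last first.
  have -> : 9 * 6 ^ j = 2 ^ j * 3 ^ (j + 2) by rewrite expnD mulnA -expnMn mulnC.
  by apply: has_oa_two_primes; rewrite // ?addn_gt0 ?(leq_trans _ j3) //;
    [apply: (@leq_exp_add1 _ _ 3) | apply: (@leq_exp_add1 _ _ 2); rewrite // leq_addl].
case: j => [|[|[|//]]] _.
- exact: (@has_oa_prime_power 3 2).
- apply: (@has_oa_wilson_ord 6 7 7 5); rewrite //; try exact: has_oa_prime.
  exact: (@has_oa_prime_power 2 3).
- apply: (@has_oa_wilson_ord 6 7 41 37); rewrite //; try exact: has_oa_prime.
  exact: (@has_oa_prime_power 2 3).
Qed.

Lemma has_oa_24_6 (j : nat) : has_oa 6 'I_(24 * 6 ^ j).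
Proof.
case: j => [|j]; first by rewrite muln1; apply: has_oa_24.
have -> : 24 * 6 ^ j.+1 = 2 ^ (j + 4) * 3 ^ (j + 2).
  by rewrite !expnD mulnACA -expnMn expnS mulnA mulnC.
by apply: has_oa_two_primes; rewrite // ?addn_gt0 ?orbT //;
   [apply: (@leq_exp_add1 _ _ 4) | apply: (@leq_exp_add1 _ _ 2)]; rewrite // leq_addl.
Qed.

Lemma has_oa_35_7 (j : nat) : has_oa 7 'I_(35 * 7 ^ j).
Proof.
case: j => [|j]; first by rewrite muln1; apply: has_oa_35.
apply: has_oa_mul has_oa_35 _; apply: has_oa_prime_power => //.
by apply: (@leq_exp_add1 _ _ 1).
Qed.

Lemma has_oa_80_10 (j : nat) : has_oa 10 'I_(80 * 10 ^ j).
Proof.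
case: j => [|j]; first by rewrite muln1; apply: has_oa_80.
have -> : 80 * 10 ^ j.+1 = 2 ^ (j + 5) * 5 ^ (j + 2).
  by rewrite !expnD mulnACA -expnMn expnS mulnA mulnC.
by apply: has_oa_two_primes; rewrite // ?addn_gt0 ?orbT //;
   [apply: (@leq_exp_add1 _ _ 5) | apply: (@leq_exp_add1 _ _ 2)]; rewrite // leq_addl.
Qed.

(** As 3 and 9 are too small, [384 = 16 * 23 + 16] and
    [4608 = 16 * 277 + 16 * 11] are treated by truncation. *)
Lemma has_oa_32_12 (j : nat) : has_oa 12 'I_(32 * 12 ^ j).
Proof.
have oa16 : has_oa 12 'I_16 by apply: (@has_oa_prime_power 2 4).
have oa17 : has_oa 12 'I_17 by apply: has_oa_prime.
have [|j3] := ltnP j 3; last first.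
  have -> : 32 * 12 ^ j = 2 ^ (5 + 2 * j) * 3 ^ j.
    by rewrite expnD expnM -mulnA -expnMn.
  apply: has_oa_two_primes; rewrite // ?(leq_trans _ j3) //.
    by apply: (@leq_exp_add1 _ _ 5); rewrite // leq_addr.
  by apply: (@leq_exp_add1 _ _ 3).
case: j => [|[|[|//]]] _.
- exact: (@has_oa_prime_power 2 5).
- have -> : 32 * 12 ^ 1 = 16 * 23 + 16 by [].
  by apply: has_oa_wilson_ord => //; apply: has_oa_prime.
- have -> : 32 * 12 ^ 2 = 16 * 277 + 16 * 11 by [].
  apply: has_oa_wilson_ord => //; first by apply: has_oa_prime.
  by apply: has_oa_mul => //; apply: has_oa_prime.
Qed.

Local Open Scope ring_scope.

(** * Equiangular tight frames as families of coordinates *)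

(** Squared norms [a], coherence [c] and frame constant [A].  Tightness is stated
    for the matrix of the frame operator, which is easier to build up blockwise
    than the quadratic form. *)
Definition etf_family (C : numClosedFieldType) (I J : finType)
    (f : I -> J -> C) (a c A : C) : Prop :=
  [/\ forall n, \sum_j f n j * (f n j)^* = a,
      forall n n', n != n' -> `|\sum_j f n j * (f n' j)^*| = c
    & forall j j', \sum_n (f n j)^* * f n j' = A *+ (j == j')].

Lemma dotmx_sum (C : numClosedFieldType) (D : nat) (u v : 'rV[C]_D) :
  dotmx u v = \sum_j u 0 j * (v 0 j)^*.
Proof. by rewrite dotmxE mxE; apply: eq_bigr => j _; rewrite !mxE. Qed.

Lemma l2norm_sqr (C : numClosedFieldType) (D : nat) (u : 'rV[C]_D) :
  l2norm u ^+ 2 = \sum_j u 0 j * (u 0 j)^*.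
Proof. by rewrite sqrtCK dotmx_sum. Qed.

Lemma etf_family_is_etf (C : numClosedFieldType) (I J : finType)
    (f : I -> J -> C) (a c A : C) :
  0 < a -> 0 < A -> etf_family f a c A ->
  exists phi : 'I_#|I| -> 'rV[C]_#|J|, is_etf phi.
Proof.
move=> a0 A0 [norm_f coh_f tight_f].
pose phi (n : 'I_#|I|) : 'rV[C]_#|J| := \row_j f (enum_val n) (enum_val j).
have dotE n n' : dotmx (phi n) (phi n') =
    \sum_j f (enum_val n) j * (f (enum_val n') j)^*.
  rewrite dotmx_sum (reindex (@enum_rank J)) /=; last exact/onW_bij/enum_rank_bij.
  by apply: eq_bigr => j _; rewrite !mxE enum_rankK.
exists phi; split.
- move=> n; apply: contraTneq a0 => phi0.
  by rewrite -(norm_f (enum_val n)) -dotE phi0 linear0l ltxx.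
- by move=> n n'; rewrite /l2norm !dotE !norm_f.
- by exists c => n n' ne; rewrite dotE coh_f // (inj_eq enum_val_inj).
exists A => // x; rewrite l2norm_sqr.
transitivity (\sum_(n : I) \sum_j \sum_j' (x 0 j)^* * x 0 j' *
    ((f n (enum_val j'))^* * f n (enum_val j))).
  rewrite [RHS](reindex (@enum_val I predT)); last exact/onW_bij/enum_val_bij.
  apply: eq_big => // n _; rewrite normCK dotmx_sum rmorph_sum mulr_suml.
  apply: eq_bigr => j _; rewrite mulr_sumr; apply: eq_bigr => j' _.
  by rewrite !mxE rmorphM /= conjCK; ring.
rewrite exchange_big mulr_sumr; apply: eq_bigr => j _ /=.
rewrite exchange_big /= (bigD1 j) //= [X in _ + X]big1 => [|j' ne]; last first.
  by rewrite -mulr_sumr tight_f (inj_eq enum_val_inj) (negPf ne) mulr0.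
by rewrite -mulr_sumr tight_f eqxx mulr1n addr0; ring.
Qed.

(** Polarisation: the values 1 and ['i] of [z] separate the two coefficients. *)
Lemma hermitian_form_eq0 (C : numClosedFieldType) (a b : C) :
  (forall z : C, z * a + z^* * b = 0) -> a = 0.
Proof.
move=> h; have := h 1; have := h 'i; rewrite conjC1 conjCi !mul1r mulNr -mulrBr.
move=> /eqP; rewrite mulf_eq0 (negPf (neq0Ci C)) subr_eq0 => /eqP <- /eqP.
by rewrite -mulr2n mulrn_eq0 => /eqP.
Qed.

(** The quadratic form of the frame operator determines its matrix; unit vectors
    give the diagonal, and sums of multiples of two of them the other entries. *)
Lemma is_etf_family (C : numClosedFieldType) (D N : nat) (phi : 'I_N -> 'rV[C]_D) :
  (1 < N)%N -> is_etf phi -> exists a c A : C,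
    [/\ 0 < a, 0 < A, 0 <= c & etf_family (fun n j => phi n 0 j) a c A].
Proof.
move=> N1 [nz norm_phi [c coh] [A A0 tight]].
pose n0 := Ordinal (ltnW N1); pose a := dotmx (phi n0) (phi n0).
exists a, c, A; split=> //.
- exact: neq0_dnorm_gt0.
- by rewrite -(coh n0 (Ordinal N1)).
split.
- by move=> n; rewrite -l2norm_sqr (norm_phi n n0) sqrtCK.
- by move=> n n' ne; rewrite -dotmx_sum coh.
pose T j j' := \sum_n (phi n 0 j)^* * phi n 0 j'.
have form x : \sum_j \sum_j' x j * (x j')^* * T j j' = A * \sum_j x j * (x j)^*.
  transitivity (\sum_n `|dotmx (phi n) (\row_j x j)| ^+ 2); last first.
    rewrite tight l2norm_sqr; congr (_ * _).
    by apply: eq_bigr => j _; rewrite !mxE.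
  transitivity (\sum_n \sum_j \sum_j'
      x j * (x j')^* * ((phi n 0 j)^* * phi n 0 j')).
    rewrite [RHS]exchange_big; apply: eq_bigr => j _ /=.
    rewrite [RHS]exchange_big; apply: eq_bigr => j' _ /=.
    by rewrite mulr_sumr.
  apply: eq_bigr => n _; rewrite normCKC dotmx_sum rmorph_sum mulr_suml.
  apply: eq_bigr => j _; rewrite mulr_sumr; apply: eq_bigr => j' _.
  by rewrite !mxE rmorphM /= conjCK; ring.
have sum1 j (F : 'I_D -> C) : \sum_i (i == j)%:R * F i = F j.
  rewrite (bigD1 j) //= eqxx mul1r big1 ?addr0 // => i /negPf ->.
  by rewrite mul0r.
have diagT j : T j j = A.
  have := form (fun i => (i == j)%:R).
  under eq_bigr => i _ do under eq_bigr => i' _ do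
    rewrite conjC_nat -mulrA mulrCA.
  under eq_bigr => i _ do rewrite sum1.
  by rewrite !sum1 conjC_nat eqxx mulr1.
move=> j j'; have [<- | ne] := eqVneq j j'; first exact: diagT.
rewrite mulr0n; apply: (@hermitian_form_eq0 _ _ (T j' j)) => z.
pose x i := (i == j')%:R * z^* + (i == j)%:R.
have xc i : (x i)^* = (i == j')%:R * z + (i == j)%:R.
  by rewrite rmorphD rmorphM /= !conjC_nat conjCK.
have sumx (F : 'I_D -> C) : \sum_i x i * F i = z^* * F j' + F j.
  under eq_bigr do rewrite mulrDl -mulrA.
  by rewrite big_split /= !sum1.
have sumxc (F : 'I_D -> C) : \sum_i (x i)^* * F i = z * F j' + F j.
  under eq_bigr do rewrite xc mulrDl -mulrA.
  by rewrite big_split /= !sum1.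
have := form x; under eq_bigr => i _ do under eq_bigr => i' _ do rewrite -mulrA mulrCA.
under eq_bigr => i _ do rewrite sumxc mulrCA -mulrDr.
under [X in _ = _ * X]eq_bigr do rewrite mulrC.
rewrite sumx sumxc !diagT /x !eqxx [j' == j]eq_sym (negPf ne) !mul0r !mul1r add0r addr0.
move=> /eqP; rewrite -subr_eq0 mulr1n => /eqP eqA; rewrite -[RHS]eqA /T; ring.
Qed.

(** The trace of the frame operator, and its value at one vector of the frame. *)
Lemma etf_family_counts (C : numClosedFieldType) (I J : finType)
    (f : I -> J -> C) (a c A : C) :
  (0 < #|I|)%N -> etf_family f a c A ->
  A * #|J|%:R = a * #|I|%:R /\ a ^+ 2 + c ^+ 2 * (#|I|.-1)%:R = A * a.
Proof.
move=> I0 [norm_f coh_f tight_f]; split.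
  transitivity (\sum_j \sum_n (f n j)^* * f n j).
    under eq_bigr do rewrite tight_f eqxx.
    by rewrite sumr_const mulr_natr.
  rewrite exchange_big; under eq_bigr => n _ do under eq_bigr => j _ do rewrite mulrC.
  by under eq_bigr do rewrite norm_f; rewrite sumr_const mulr_natr.
have /card_gt0P[n0 _] := I0.
transitivity (\sum_n `|\sum_j f n j * (f n0 j)^*| ^+ 2).
  rewrite (bigD1 n0) //= norm_f ger0_norm; last first.
    by rewrite -(norm_f n0) sumr_ge0 // => j _; rewrite mul_conjC_ge0.
  congr (_ + _); rewrite (eq_bigr (fun=> c ^+ 2)) => [|n ne]; last by rewrite coh_f.
  by rewrite sumr_const cardC1 mulr_natr.
transitivity (\sum_n \sum_j \sum_j'
    ((f n0 j)^* * f n0 j') * ((f n j')^* * f n j)).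
  apply: eq_bigr => n _; rewrite normCK rmorph_sum mulr_suml.
  apply: eq_bigr => j _; rewrite mulr_sumr; apply: eq_bigr => j' _.
  by rewrite rmorphM /= conjCK; ring.
rewrite exchange_big -(norm_f n0) mulr_sumr; apply: eq_bigr => j _ /=.
rewrite exchange_big /= (bigD1 j) //= [X in _ + X]big1 => [|j' ne].
  by rewrite -mulr_sumr tight_f eqxx addr0 mulr1n; ring.
by rewrite -mulr_sumr tight_f (negPf ne) mulr0.
Qed.

Lemma etf_family_scale (C : numClosedFieldType) (I J : finType)
    (f : I -> J -> C) (a c A : C) :
  0 < c -> etf_family f a c A ->
  etf_family (fun n j => f n j / sqrtC c) (a / c) 1 (A / c).
Proof.
move=> c0 [norm_f coh_f tight_f].
have sc : (sqrtC c)^-1 * ((sqrtC c)^-1)^* = c^-1.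
  have real_sc : (sqrtC c)^-1 \is Num.real.
    by rewrite rpredV; apply: ger0_real; rewrite sqrtC_ge0 ltW.
  by rewrite (CrealP real_sc) -expr2 exprVn sqrtCK.
have sumE n n' : \sum_j f n j / sqrtC c * (f n' j / sqrtC c)^* =
    (\sum_j f n j * (f n' j)^*) / c.
  rewrite mulr_suml; apply: eq_bigr => j _; rewrite -sc rmorphM /=; ring.
split.
- by move=> n; rewrite sumE norm_f.
- by move=> n n' ne; rewrite sumE normrM coh_f // gtr0_norm ?invr_gt0 // divff // gt_eqF.
move=> j j'; rewrite -mulrnAl -tight_f mulr_suml; apply: eq_bigr => n _.
by rewrite -sc rmorphM /=; ring.
Qed.

(** * Roots of unity and simplices *)

(** The polynomial [X^n - 1] is separable in characteristic zero, so it has [n]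
    roots, and a finite group of roots of unity is cyclic. *)
Lemma ex_primitive_root (C : numClosedFieldType) (n : nat) :
  (0 < n)%N -> exists z : C, n.-primitive_root z.
Proof.
move=> n0; pose p : {poly C} := 'X^n - 1.
have [r defp] := closed_field_poly_normal p.
have monp : p \is monic by apply: monicXnsubC.
have : p = \prod_(z <- r) ('X - z%:P) by rewrite {1}defp (monicP monp) scale1r.
move=> {}defp.
have size_r : size r = n.
  by have := size_prod_XsubC r id; rewrite /= -defp size_XnsubC // => -[].
have uniq_r : uniq r.
  by rewrite -separable_prod_XsubC -defp separable_Xn_sub_1 // pnatr_eq0 -lt0n.
have all_r : all n.-unity_root r.
  by apply/allP => z zr; rewrite /root_of_unity -/p defp root_prod_XsubC.
have /hasP[z _ prim_z] := cyclic.has_prim_root n0 all_r uniq_r (eq_leq (esym size_r)).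
by exists z.
Qed.

(** The Fourier matrix, with the constant row and column numbered [ord0]. *)
Lemma ex_dft (C : numClosedFieldType) (n : nat) : exists E : 'I_n.+1 -> 'I_n.+1 -> C,
  [/\ forall s t, `|E s t| = 1, forall s, E s ord0 = 1,
      forall s s', \sum_t E s t * (E s' t)^* = n.+1%:R *+ (s == s')
    & forall t t', \sum_s (E s t)^* * E s t' = n.+1%:R *+ (t == t')].
Proof.
have [z prim_z] := ex_primitive_root C (ltn0Sn n).
pose E (s t : 'I_n.+1) := z ^+ (s * t).
have normz : `|z| = 1.
  apply: (pexpIrn (ltn0Sn n)); rewrite ?nnegrE // -normrX.
  by rewrite (prim_expr_order prim_z) normr1 expr1n.
have normE s t : `|E s t| = 1 by rewrite normrX normz expr1n.
have symE s t : E s t = E t s by rewrite /E mulnC.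
have orthE s s' : \sum_t E s t * (E s' t)^* = n.+1%:R *+ (s == s').
  have [<- | ne] := eqVneq s s'.
    rewrite (eq_bigr (fun=> 1)) => [|t _]; last by rewrite -normCK normE expr1n.
    by rewrite sumr_const card_ord mulr1n.
  pose w := z ^+ s * (z ^+ s')^*.
  have zz : z * z^* = 1 by rewrite -normCK normz expr1n.
  have wn : w ^+ n.+1 = 1.
    rewrite exprMn -rmorphXn /= -!exprM ![(_ * n.+1)%N]mulnC !exprM.
    by rewrite (prim_expr_order prim_z) !expr1n rmorph1 mulr1.
  have w1 : w != 1.
    apply: contra ne => /eqP w1; rewrite -(inj_eq val_inj).
    rewrite -[val s](modn_small (ltn_ord s)) -[val s'](modn_small (ltn_ord s')).
    rewrite -(eq_prim_root_expr prim_z).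
    have -> : z ^+ s = w * z ^+ s'.
      by rewrite -mulrA [_^* * _]mulrC rmorphXn -exprMn zz expr1n mulr1.
    by rewrite w1 mul1r.
  rewrite mulr0n (eq_bigr (fun t : 'I_n.+1 => w ^+ t)) => [|t _]; last first.
    by rewrite /E !exprM rmorphXn -exprMn.
  have /eqP := subrX1 w n.+1; rewrite wn subrr eq_sym mulf_eq0 subr_eq0 (negPf w1) /=.
  by move/eqP.
exists E; split=> // t t'.
rewrite eq_sym -orthE; apply: eq_bigr => s _.
by rewrite mulrC symE [E s t]symE.
Qed.

(** The Fourier matrix without its constant column: its rows are the vertices of
    a regular simplex, and its columns remain orthogonal to the constants. *)
Lemma ex_simplex (C : numClosedFieldType) (w : nat) : exists G : 'I_w.+1 -> 'I_w -> C,
  [/\ forall h t, `|G h t| = 1, forall t, \sum_h (G h t)^* = 0,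
      forall h h', \sum_t G h t * (G h' t)^* = w.+1%:R *+ (h == h') - 1
    & forall t t', \sum_h (G h t)^* * G h t' = w.+1%:R *+ (t == t')].
Proof.
have [E [normE E0 rowE colE]] := ex_dft C w.
exists (fun h t => E h (lift ord0 t)); split=> [|t|h h'|t t'] //.
- have := colE (lift ord0 t) ord0.
  by rewrite eq_sym (negPf (neq_lift _ _)) mulr0n; under eq_bigr do rewrite E0 mulr1.
- by rewrite -rowE big_ord_recl !E0 conjC1 mulr1 addrC addKr.
Qed.

(** * The frame built on a group divisible design *)

(** Here [s] is S-1 and [phi] is the normalised old frame.  The condition on
    [a - s] also allows the empty frame, with [a = 0] and [s = 1], for
    which the construction yields the Steiner frame of a BIBD. *)
Lemma gdd_etf_family (C : numClosedFieldType) (I P X J : finType)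
    (k s w : nat) (blk : X -> {set I * P}) (phi : P * 'I_s -> J -> C) (a : C) :
  gdd_family k blk -> (forall v, #|[set x | v \in blk x]| = (s * w)%N) ->
  (0 < s)%N -> (0 < w)%N -> `|a - s%:R| = 1 -> etf_family phi a 1 (k * s)%:R ->
  exists f : (I * P) * ('I_s * 'I_w.+1) -> X + I * J -> C,
    etf_family f (a + (s * w)%:R) 1 (k * s * w.+1)%:R.
Proof.
move=> [cardB sameG exB uniqB] repl s0 w0 a_s [norm_phi coh_phi tight_phi].
have [E [normE rowE colE]] : exists E : 'I_s -> 'I_s -> C,
    [/\ forall t t', `|E t t'| = 1,
        forall t t', \sum_i E t i * (E t' i)^* = s%:R *+ (t == t')
      & forall t t', \sum_i (E i t)^* * E i t' = s%:R *+ (t == t')].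
  by case: (s) s0 => // s' _; have [E [? _ ? ?]] := ex_dft C s'; exists E.
have [G [normG sumG rowG colG]] := ex_simplex C w.
have lab_ex v : exists2 lab : X -> 'I_s * 'I_w,
    {in [set x | v \in blk x] &, injective lab} &
    [set lab x | x in [set x | v \in blk x]] = setT.
  by apply: ex_labelling; rewrite ?repl card_prod !card_ord // muln_gt0 s0.
have /fin_all_exists2[lab inj_lab im_lab] := lab_ex.
(* Entry of the tensor product in row [m] and column [l]; around each vertex
   [v] the map [lab v] assigns the columns to the blocks through [v]. *)
pose F (l : 'I_s * 'I_w) (m : 'I_s * 'I_w.+1) : C := E m.1 l.1 * G m.2 l.2.
have normF l m : `|F l m| = 1 by rewrite normrM normE normG mulr1.
(* A new vector is named by its vertex [n.1], its old vector [(n.1.2, n.2.1)]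
   and its row [n.2]. *)
pose f (n : (I * P) * ('I_s * 'I_w.+1)) (z : X + I * J) : C :=
  match z with
  | inl x => if n.1 \in blk x then F (lab n.1 x) n.2 else 0
  | inr c => if n.1.1 == c.1 then phi (n.1.2, n.2.1) c.2 else 0
  end.
have rowF m m' : \sum_l F l m * (F l m')^* =
    (s%:R *+ (m.1 == m'.1)) * (w.+1%:R *+ (m.2 == m'.2) - 1).
  rewrite -rowE -rowG big_distrlr /= pair_bigA /=; apply: eq_bigr => l _.
  by rewrite /F rmorphM mulrACA.
have colF l l' : \sum_m (F l m)^* * F l' m = (s * w.+1)%:R *+ (l == l').
  have -> : (s * w.+1)%:R *+ (l == l') =
      (s%:R *+ (l.1 == l'.1)) * (w.+1%:R *+ (l.2 == l'.2)) :> C.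
    case: l l' => [t h] [t' h']; rewrite xpair_eqE /= natrM.
    by case: (t == t'); case: (h == h'); rewrite ?mulr1n ?mulr0n ?mulr0 ?mul0r.
  rewrite -colE -colG big_distrlr /= pair_bigA /=; apply: eq_bigr => m _.
  by rewrite /F rmorphM mulrACA.
have blockE v (H : 'I_s * 'I_w -> C) :
    \sum_x (if v \in blk x then H (lab v x) else 0) = \sum_l H l.
  rewrite -big_mkcond /= (eq_bigl (fun x => x \in [set x | v \in blk x])).
    2: by move=> x; rewrite inE.
  rewrite -(big_imset _ (inj_lab v)) /= im_lab.
  by apply: eq_bigl => l; rewrite inE.
have same_point u u' p : (u == u') = ((u, p) == (u', p) :> I * P).
  by rewrite xpair_eqE eqxx andbT.
have innerE n n' : \sum_z f n z * (f n' z)^* =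
    \sum_x (if (n.1 \in blk x) && (n'.1 \in blk x)
            then F (lab n.1 x) n.2 * (F (lab n'.1 x) n'.2)^* else 0) +
    (if n.1.1 == n'.1.1 then
       \sum_j phi (n.1.2, n.2.1) j * (phi (n'.1.2, n'.2.1) j)^* else 0).
  rewrite big_sumType /=; congr (_ + _).
    apply: eq_bigr => x _; case: (n.1 \in blk x) => /=; last by rewrite mul0r.
    by case: (n'.1 \in blk x); rewrite // rmorph0 mulr0.
  rewrite -(pair_bigA _ (fun u j => (if n.1.1 == u then phi (n.1.2, n.2.1) j else 0) *
     (if n'.1.1 == u then phi (n'.1.2, n'.2.1) j else 0)^*)) /=.
  rewrite (bigD1 n.1.1) //= [X in _ + X]big1 ?addr0 => [|u /negPf ne]; last first.
    by apply: big1 => j _; rewrite eq_sym ne mul0r.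
  rewrite eqxx eq_sym; case: ifP => // _.
  by apply: big1 => j _; rewrite rmorph0 mulr0.
have same_vertex v m m' : \sum_z f (v, m) z * (f (v, m') z)^* =
    (s%:R *+ (m.1 == m'.1)) * (w.+1%:R *+ (m.2 == m'.2) - 1) +
    \sum_j phi (v.2, m.1) j * (phi (v.2, m'.1) j)^*.
  rewrite innerE /= eqxx -rowF -(blockE v); congr (_ + _).
  by apply: eq_bigr => x _; rewrite andbb.
exists f; split.
- move=> [v m]; rewrite same_vertex !eqxx norm_phi !mulr1n.
  by rewrite -natr1 addrK natrM addrC.
- move=> [v m] [v' m'] ne; have [eqv | nev] := eqVneq v v'.
    rewrite -{v'}eqv in ne *; rewrite same_vertex.
    have [eq1 | ne1] := eqVneq m.1 m'.1; last first.
      rewrite mulr0n mul0r add0r coh_phi //.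
      by rewrite xpair_eqE eqxx.
    rewrite -eq1 norm_phi; have -> : (m.2 == m'.2) = false.
      apply/negbTE; apply: contra ne => /eqP eq2.
      by rewrite [m]surjective_pairing [m']surjective_pairing eq1 eq2.
    by rewrite mulr1n mulr0n add0r mulrN1 addrC.
  rewrite innerE /=; have [eq1 | ne1] := eqVneq v.1 v'.1.
    rewrite big1 ?add0r => [|x _]; last first.
      case: ifP => // /andP[vx v'x].
      by rewrite (sameG _ _ _ vx v'x eq1) eqxx in nev.
    apply: coh_phi; apply: contra nev; rewrite xpair_eqE => /andP[/eqP eq2 _].
    by rewrite [v]surjective_pairing [v']surjective_pairing eq1 eq2.
  have [x [vx v'x]] := exB _ _ ne1.
  rewrite addr0 (bigD1 x) //= vx v'x big1 ?addr0 => [|y ney].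
    by rewrite normrM norm_conjC !normF mulr1.
  case: ifP => // /andP[vy v'y].
  by rewrite (uniqB _ _ _ _ ne1 vx v'x vy v'y) eqxx in ney.
have tightE z z' : \sum_n (f n z)^* * f n z' =
    \sum_v \sum_m (f (v, m) z)^* * f (v, m) z'.
  by rewrite pair_bigA /=; apply: eq_bigr => -[].
have cross v x u j : \sum_m (f (v, m) (inl x))^* * f (v, m) (inr (u, j)) = 0.
  rewrite /f /=; case: (v \in blk x); last first.
    by apply: big1 => m _; rewrite rmorph0 mul0r.
  case: (v.1 == u); last by apply: big1 => m _; rewrite mulr0.
  rewrite -(pair_bigA _ (fun t h => (F (lab v x) (t, h))^* * phi (v.2, t) j)) /=.
  apply: big1 => t _; rewrite -mulr_suml /F /=.
  under eq_bigr do rewrite rmorphM /=.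
  by rewrite -mulr_sumr sumG mulr0 mul0r.
case=> [x | [u j]] [x' | [u' j']]; rewrite tightE.
- have [<- | ne] := eqVneq x x'.
    rewrite (eq_bigr (fun v => if v \in blk x then (s * w.+1)%:R else 0)) => [|v _].
      rewrite -big_mkcond sumr_const cardB eqxx mulr1n.
      by rewrite -mulrnA mulnC mulnA.
    rewrite /f /=; case: (v \in blk x); first by rewrite colF eqxx.
    by apply: big1 => m _; rewrite mulr0.
  rewrite (_ : (inl x == inl x') = false) ?mulr0n; last first.
    by apply: contraNF ne => /eqP[->].
  apply: big1 => v _; rewrite /f /=.
  have [vx | _] := boolP (v \in blk x); last by apply: big1 => m _; rewrite rmorph0 mul0r.
  have [vx' | _] := boolP (v \in blk x'); last by apply: big1 => m _; rewrite mulr0.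
  rewrite colF; case: eqP => // /inj_lab eqx.
  by rewrite eqx ?eqxx ?inE // in ne.
- by rewrite big1 // => v _; apply: cross.
- rewrite big1 // => v _; apply: (inv_inj (@conjCK C)).
  rewrite rmorph_sum rmorph0 -[RHS](cross v x' u j); apply: eq_bigr => m _.
  by rewrite rmorphM /= conjCK mulrC.
- pose T p := \sum_(t < s) (phi (p, t) j)^* * phi (p, t) j'.
  have sumT : \sum_p T p = (k * s)%:R *+ (j == j').
    rewrite -tight_phi /T pair_bigA /=.
    by apply: eq_bigr => -[].
  rewrite (eq_bigr (fun v => if (v.1 == u) && (v.1 == u') then T v.2 *+ w.+1 else 0)).
    rewrite -(pair_bigA _ (fun i p =>
      if (i == u) && (i == u') then T p *+ w.+1 else 0)) /=.
    rewrite (bigD1 u) //= [X in _ + X]big1 ?addr0 => [|i /negPf ->]; last first.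
      by rewrite big1.
    rewrite eqxx -sum_eqE /= xpair_eqE; case: (u == u') => /=; last by rewrite big1.
    rewrite sumrMnl sumT; case: (j == j'); last by rewrite !mulr0n mul0rn.
    by rewrite !mulr1n -mulrnA.
  move=> v _; rewrite /f /=; case: (v.1 == u); last first.
    by apply: big1 => m _; rewrite rmorph0 mul0r.
  case: (v.1 == u'); last by apply: big1 => m _; rewrite mulr0.
  rewrite -(pair_bigA _ (fun t (h : 'I_w.+1) => (phi (v.2, t) j)^* * phi (v.2, t) j')) /=.
  by rewrite -sumrMnl; apply: eq_bigr => t _; rewrite sumr_const card_ord.
Qed.

(** * Counting in designs and the arithmetic of types *)

(** Double counting of the pairs formed by a block through [v] and a further
    point of it. *)
Lemma gdd_replication (I P X : finType) (k : nat) (blk : X -> {set I * P}) v :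
  gdd_family k blk ->
  (#|[set x | v \in blk x]| * k.-1 = #|P| * #|I|.-1)%N.
Proof.
move=> [cardB sameG exB uniqB].
transitivity (\sum_(x | v \in blk x) \sum_(w | (w \in blk x) && (w != v)) 1)%N.
  rewrite -sum_nat_const; apply: eq_big => [x|x]; rewrite inE // => vx.
  rewrite sum1_card -(cardB x) (cardD1 v) vx /=.
  by apply: eq_card => w; rewrite !inE andbC.
rewrite (exchange_big_dep (fun w => w != v)) /= => [|x w _ /andP[]//].
rewrite (eq_bigr (fun w : I * P => (w.1 != v.1 : nat))) => [|w ne]; last first.
  have [eq1 | ne1] := eqVneq w.1 v.1.
    apply: big1 => x /andP[vx /andP[wx _]].
    by rewrite (sameG _ _ _ wx vx eq1) eqxx in ne.
  have [x [wx vx]] := exB _ _ ne1; rewrite (big_pred1 x) // => y.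
  apply/idP/eqP => [/andP[vy /andP[wy _]] | ->]; last by rewrite vx wx.
  exact: uniqB ne1 wy vy wx vx.
rewrite -big_mkcondr /= sum1_card.
transitivity #|setX [set~ v.1] [set: P]|.
  apply: eq_card => w; rewrite !inE andbT.
  by apply/andP/idP => [[] // | ne1]; split=> //; apply: contra ne1 => /eqP ->.
by rewrite cardsX cardsT cardsC1 mulnC.
Qed.

Lemma gdd_card_blocks (I P X : finType) (k r : nat) (blk : X -> {set I * P}) :
  gdd_family k blk -> (forall v, #|[set x | v \in blk x]| = r) ->
  (#|X| * k = #|I| * #|P| * r)%N.
Proof.
move=> [cardB _ _ _] repl.
transitivity (\sum_x \sum_(v | v \in blk x) 1)%N.
  by rewrite (eq_bigr (fun=> k)) ?sum_nat_const // => x _; rewrite sum1_card.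
rewrite (exchange_big_dep predT) //= (eq_bigr (fun=> r)) => [|v _].
  by rewrite sum_nat_const card_prod.
by rewrite -(repl v) -sum1_card; apply: eq_bigl => x; rewrite inE.
Qed.

Lemma etf_family_reindex (C : numClosedFieldType) (I I' J : finType) (h : I' -> I)
    (f : I -> J -> C) (a c A : C) :
  bijective h -> etf_family f a c A -> etf_family (f \o h) a c A.
Proof.
move=> bij_h [norm_f coh_f tight_f]; split=> [n | n n' ne | j j'].
- exact: norm_f.
- by apply: coh_f; rewrite (inj_eq (bij_inj bij_h)).
- by rewrite -tight_f [RHS](reindex h) //; apply: onW_bij.
Qed.

(** Types (K,-1,S) in terms of natural numbers: [S = s.+1], and [m] is
    S(K-1) - 1. *)
Lemma is_of_type_neg (D N K s m : nat) :
  (1 < K)%N -> m.+1 = (s.+1 * K.-1)%N -> (D * K = s.+1 * m)%N -> N = (s * m)%N ->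
  (1 < D < N)%N -> is_of_type D N K%:R (-1) s.+1%:R.
Proof.
move=> K1 defm DK -> DN.
have K0 : K%:R != 0 :> rat by rewrite pnatr_eq0 -lt0n ltnW.
have defm' : m%:R = s.+1%:R * (K%:R - 1) - 1 :> rat.
  have -> : K%:R - 1 = (K.-1)%:R :> rat by rewrite -subn1 natrB // ltnW.
  by rewrite -natrM -defm -natr1 addrK.
split=> //.
- by split; rewrite ?rpred_nat ?ltr0n //; right.
- by rewrite -defm' mulrAC -natrM -DK natrM mulfK.
- by rewrite -defm' -[s.+1]addn1 natrD addrK natrM.
Qed.

Lemma of_type_neg_inv (D N K : nat) (S : int) :
  is_of_type D N K%:R (-1) S%:~R ->
  exists s m : nat, [/\ S = s.+1, (0 < s)%N, (1 < K)%N & m.+1 = (s.+1 * K.-1)%N] /\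
   [/\ (D * K = s.+1 * m)%N, N = (s * m)%N & (1 < D < N)%N].
Proof.
move=> [[_ _ S0 _] DN defD defN]; move: S0; rewrite ltr0z => S0.
have /andP[D1 ltDN] := DN.
have K0 : (0 < K)%N.
  rewrite lt0n; apply: contraTneq D1 => K0; move: defD; rewrite K0 invr0 mulr0 mul0r.
  by move/eqP; rewrite pnatr_eq0 => /eqP ->.
have DK : D%:Z * K%:Z = S * (S * (K%:Z - 1) - 1).
  apply: (@intr_inj rat); rewrite !rmorphM /= !rmorphB /= rmorphM /= rmorphB /=.
  rewrite -!pmulrn defD.
  field.
  by rewrite pnatr_eq0 -lt0n.
have NE : N%:Z = (S - 1) * (S * (K%:Z - 1) - 1).
  apply: (@intr_inj rat); rewrite !rmorphM /= !rmorphB /= rmorphM /= rmorphB /= -!pmulrn.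
  by rewrite defN.
case: S S0 DK NE {defD defN} => // S' S0 DK NE.
have M0 : 0 < S'%:Z * (K%:Z - 1) - 1 by nia.
have S1 : (1 < S')%N by nia.
exists S'.-1, (S' * K.-1).-1; split; first by split; nia.
by split=> //; nia.
Qed.

(** * From one frame of type (K,-1,S) to another *)

Lemma etf_of_type_family (R : realType) (I J : finType)
    (f : I -> J -> R[i]) (a c A : R[i]) (K s m : nat) :
  0 < a -> 0 < A -> etf_family f a c A ->
  (1 < K)%N -> m.+1 = (s.+1 * K.-1)%N -> (#|J| * K = s.+1 * m)%N -> #|I| = (s * m)%N ->
  (1 < #|J| < #|I|)%N -> etf_of_type_exists R K%:R (-1) s.+1%:R.
Proof.
move=> a0 A0 etf_f K1 defm cardJ cardI lt_card.
have [phi etf_phi] := etf_family_is_etf a0 A0 etf_f.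
exists #|J|, #|I|, phi; split=> //.
exact: is_of_type_neg defm cardJ cardI lt_card.
Qed.

Lemma group_size_factor (K m s t : nat) :
  (1 < K)%N -> m.+1 = (s.+1 * K.-1)%N -> K.-2 = (t * s)%N -> m = (s * (K.-1 + t))%N.
Proof. by case: K => [|[|k]] //= _; rewrite mulSn mulnDr => defm defk; nia. Qed.

(** Eliminating [A] from the two counts gives equality in the Welch bound,
    [c^2 D (N-1) = a^2 (N-D)].  For type (K,-1,S) both [N-1] and [N-D] contain
    the factor [e = SK - S - K], which cancels and leaves [a = c S]. *)
Lemma coherence_of_type (C : numClosedFieldType) (D N K s m : nat) (a c A : C) :
  (1 < K)%N -> m.+1 = (s.+1 * K.-1)%N -> (D * K = s.+1 * m)%N -> N = (s * m)%N ->
  (1 < D < N)%N -> 0 < a -> 0 <= c ->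
  A * D%:R = a * N%:R -> a ^+ 2 + c ^+ 2 * (N.-1)%:R = A * a ->
  a = c * s.+1%:R /\ A = c * (K * s)%:R.
Proof.
move=> K1 defm DK NE /andP[D1 DN] a0 c0 tr bound.
have [s0 m0] : (0 < s)%N /\ (0 < m)%N.
  by apply/andP; rewrite -muln_gt0 -NE; lia.
have D0 : D%:R != 0 :> C by rewrite pnatr_eq0; lia.
have DK' : D%:R * K%:R = s.+1%:R * m%:R :> C by rewrite -!natrM DK.
have [e [e0 defe]] : exists e, (0 < e)%N /\ (s * K = s.+1 + e)%N.
  exists (s * K - s.+1)%N; rewrite subn_gt0.
  suff lt : (s.+1 < s * K)%N by rewrite subnKC // ltnW.
  rewrite -(ltn_pmul2r m0) -DK mulnAC -NE ltn_pmul2r //; lia.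
have predN : N.-1 = (s.+1 * e)%N.
  suff : N = (s.+1 * e).+1 by move=> ->.
  apply/eqP; rewrite -(eqn_add2r s) NE addSn -addnS -mulnSr defm.
  case: K K1 defe {DK DK' defm} => // k _ /= ; rewrite mulnSr => defe.
  rewrite mulnCA (_ : s * k = e.+1)%N; last by lia.
  by rewrite mulnS addnC.
have sK : s%:R * K%:R = s.+1%:R + e%:R :> C by rewrite -natrM -natrD defe.
have em0 : e%:R * m%:R != 0 :> C by rewrite -natrM pnatr_eq0 muln_eq0; lia.
have sqr_eq : a ^+ 2 = (c * s.+1%:R) ^+ 2.
  apply: (mulIf em0); apply/eqP; rewrite -subr_eq0; apply/eqP.
  rewrite predN NE !natrM in bound tr.
  have eq1 : (a ^+ 2 + c ^+ 2 * (s.+1%:R * e%:R)) * (D%:R * K%:R) =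
      a ^+ 2 * m%:R * (s%:R * K%:R).
    rewrite bound (_ : A * a * (D%:R * K%:R) = (A * D%:R) * a * K%:R); last by ring.
    by rewrite tr; ring.
  rewrite DK' sK in eq1.
  rewrite -[RHS](subrr (a ^+ 2 * m%:R * (s.+1%:R + e%:R))) -{2}eq1; ring.
have aE : a = c * s.+1%:R.
  by apply/eqP; rewrite -(eqrXn2 (n := 2)) ?sqr_eq ?(ltW a0) // mulr_ge0.
split=> //; apply: (mulIf D0); rewrite tr aE NE -!mulrA -!natrM.
by congr (_ * _%:R); rewrite mulnCA -DK; lia.
Qed.

(** The number of blocks through a vertex is a multiple of S-1: it equals
    [M q] where [U - 1 = (K - 1) q], and S-1 divides [M] by
    [group_size_factor]. *)
Lemma etf_of_type_gdd (R : realType) (K M U : nat) (S : int) :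
  etf_of_type_exists R K%:R (-1) S%:~R ->
  (K%:R - 2) / (S%:~R - 1) \is a @Num.int rat ->
  M%:Z = S * (K%:Z - 1) - 1 ->
  U = 1%N \/ (1 < U)%N /\ has_gdd K 'I_U 'I_M ->
  etf_of_type_exists R K%:R (-1) ((M%:R * U%:R + 1) / (K%:R - 1)).
Proof.
move=> etfS int_s defM caseU; have [D [N [phi [typeDN etf_phi]]]] := etfS.
have [s [m [[defS s0 K1 defm] [DK NE ltDN]]]] := of_type_neg_inv typeDN.
have {}defM : M = m.
  move: defM; rewrite defS (_ : K%:Z - 1 = K.-1); last by lia.
  by rewrite -PoszM -defm; lia.
rewrite {M}defM in caseU *.
have K1E : K%:R - 1 = (K.-1)%:R :> rat by rewrite -subn1 natrB // ltnW.
have K1neq0 : (K.-1)%:R != 0 :> rat by rewrite pnatr_eq0; lia.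
have m1E : m%:R + 1 = s.+1%:R * (K.-1)%:R :> rat by rewrite natr1 defm natrM.
case: caseU => [-> | [U1 [X [blk gddB]]]].
  by rewrite mulr1 K1E m1E mulfK // -[s.+1%:R]/((Posz s.+1)%:~R) -defS.
have [t defK2] : exists t, K.-2 = (t * s)%N.
  move: int_s; rewrite defS (_ : (Posz s.+1)%:~R - 1 = s%:R :> rat); last first.
    by rewrite -pmulrn -natr1 addrK.
  move=> /intrP[z defz]; have : K%:Z - 2 = z * s%:Z.
    apply: (@intr_inj rat); rewrite rmorphB rmorphM /= -!pmulrn -defz divfK //.
    by rewrite pnatr_eq0 -lt0n.
  case: z {defz} => z; first by rewrite -PoszM => defK; exists z; lia.
  have zs : (0 < z.+1 * s)%N by rewrite muln_gt0.
  rewrite NegzE mulNr -PoszM; lia.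
have mE := group_size_factor K1 defm defK2.
have m0 : (0 < m)%N by rewrite mE muln_gt0 s0 addn_gt0; lia.
(* As [m + 1] is a multiple of K-1, the numbers [m] and K-1 are coprime. *)
have [q defU] : exists q, U.-1 = (q * K.-1)%N.
  have := gdd_replication (Ordinal (ltnW U1), Ordinal m0) gddB.
  rewrite !card_ord => replE.
  have co : coprime K.-1 m.
    by have := coprimenS m; rewrite defm coprimeMr coprime_sym => /andP[_];
       rewrite coprime_sym.
  have : (K.-1 %| m * U.-1)%N by rewrite -replE dvdn_mull.
  by rewrite Gauss_dvdr // => /dvdnP.
have q0 : (0 < q)%N by rewrite lt0n; apply/eqP => q0; rewrite q0 mul0n in defU; lia.
pose w := ((K.-1 + t) * q)%N.
have defsw : (m * q = s * w)%N by rewrite /w mE mulnA.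
have repl v : #|[set x | v \in blk x]| = (s * w)%N.
  have := gdd_replication v gddB; rewrite !card_ord defU mulnA => /eqP.
  by rewrite eqn_pmul2r ?defsw; [move/eqP | lia].
have w0 : (0 < w)%N by rewrite muln_gt0 q0 addn_gt0; lia.
have N1 : (1 < N)%N by lia.
have [a [c [A [a0 A0 c0 fam]]]] := is_etf_family N1 etf_phi.
have [|tr bound] := etf_family_counts _ fam; first by rewrite card_ord; lia.
rewrite !card_ord in tr bound.
have [aE AE] := coherence_of_type K1 defm DK NE ltDN a0 c0 tr bound.
have c_gt0 : 0 < c.
  by rewrite lt_def c0 andbT; apply: contraTneq a0 => c00; rewrite aE c00 mul0r ltxx.
have := etf_family_scale c_gt0 fam; rewrite AE aE ![c * _]mulrC !mulfK ?gt_eqF // => fam1.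
have [h bij_h] : exists h : 'I_m * 'I_s -> 'I_N, bijective h.
  by apply: card_eq_bij; rewrite card_prod !card_ord NE mulnC.
have fam2 := etf_family_reindex bij_h fam1.
have coh1 : `|s.+1%:R - s%:R| = 1 :> R[i] by rewrite -natr1 addrC addKr normr1.
have [f fam3] := gdd_etf_family gddB repl s0 w0 coh1 fam2.
have defmU : ((U * m).+1 = (s * w.+1).+1 * K.-1)%N.
  rewrite -(prednK (ltnW U1)) defU mulSn mulnAC [(q * m)%N]mulnC defsw mulSn mulnS mulnDl.
  by move: defm; rewrite mulSn; lia.
have -> : (m%:R * U%:R + 1) / (K%:R - 1) = (s * w.+1).+1%:R :> rat.
  by rewrite K1E; apply: (mulIf K1neq0); rewrite divfK // -natrM natr1 -natrM mulnC defmU.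
have cardX := gdd_card_blocks gddB repl.
rewrite !card_ord in cardX.
have cardJ : (#|{: X + 'I_U * 'I_D}| * K = (s * w.+1).+1 * (U * m))%N.
  rewrite card_sum card_prod !card_ord mulnDl cardX -[(U * D * K)%N]mulnA DK.
  rewrite [(s.+1 * m)%N]mulnC [(U * (m * _))%N]mulnA -mulnDr mulnC mulnS.
  by congr (_ * _)%N; lia.
have Um : (0 < U * m)%N by rewrite muln_gt0 m0 ltnW.
have [D1 _] := andP ltDN.
apply: (etf_of_type_family _ _ fam3 K1 defmU) => //.
- by rewrite -natrD ltr0n.
- by rewrite ltr0n !muln_gt0 s0 (ltnW K1).
- by rewrite !card_prod !card_ord mulnC.
apply/andP; split.
  rewrite card_sum card_prod !card_ord; apply: leq_trans (leq_addl _ _).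
  by rewrite (leq_trans D1) // leq_pmull // ltnW.
rewrite -(ltn_pmul2r (ltnW K1)) cardJ !card_prod !card_ord [ltnRHS]mulnAC mulnC -!mulnA.
rewrite ltn_pmul2l ?(ltnW U1) // ltn_pmul2l // mulnC.
have : (1 < s * w.+1)%N by apply: (@leq_trans w.+1); rewrite // leq_pmull.
rewrite mulnC; move: (w.+1 * s)%N => x x1.
by apply: (@leq_trans (2 * x)); rewrite ?leq_mul2r ?K1 ?orbT //; lia.
Qed.

(** * Seeds: Steiner frames and Hoggar lines *)

(** The general construction applied to the frame without coordinates. *)
Lemma steiner_etf (R : realType) (k v w K s m : nat) :
  has_gdd k 'I_v 'I_1 -> (1 < k)%N -> (0 < w)%N -> (w * k.-1 = v.-1)%N ->
  (1 < K)%N -> m.+1 = (s.+1 * K.-1)%N -> (v * w * K = s.+1 * m * k)%N ->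
  (v * w.+1 = s * m)%N -> (k < v * w)%N -> (w < k * w.+1)%N ->
  etf_of_type_exists R K%:R (-1) s.+1%:R.
Proof.
move=> [X [blk gddB]] k1 w0 wE K1 defm DK NE ltk ltw.
have repl u : #|[set x | u \in blk x]| = (1 * w)%N.
  have := gdd_replication u gddB; rewrite !card_ord mul1n -wE.
  by move/eqP; rewrite eqn_pmul2r ?mul1n; [move/eqP | lia].
have coh1 : `|0 - 1%:R| = 1 :> R[i] by rewrite sub0r normrN1.
have fam0 : etf_family (fun (_ : 'I_1 * 'I_1) (j : void) => 0 : R[i]) 0 1 (k * 1)%:R.
  split=> [n | n n' | []]; first by rewrite big1 // => -[].
  by case: n n' => [i j] [i' j']; rewrite !ord1 eqxx.
have [f fam] := gdd_etf_family gddB repl isT w0 coh1 fam0.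
have := gdd_card_blocks gddB repl; rewrite !card_ord muln1 mul1n => cardX.
have k0 : (0 < k)%N by lia.
have cardJ : #|{: X + 'I_v * void}| = #|X|.
  by rewrite card_sum card_prod card_void muln0 addn0.
apply: (etf_of_type_family _ _ fam K1 defm).
- by rewrite add0r ltr0n muln_gt0.
- by rewrite ltr0n !muln_gt0 k0.
- by apply/eqP; rewrite cardJ -(eqn_pmul2r k0) mulnAC cardX DK.
- by rewrite !card_prod !card_ord muln1 mul1n NE.
have v0 : (0 < v)%N by apply: contraTT (leq_ltn_trans (leq0n k) ltk); case: (v).
rewrite cardJ !card_prod !card_ord muln1 mul1n -(ltn_pmul2r k0) mul1n cardX ltk.
by rewrite -(ltn_pmul2r k0) cardX -mulnA ltn_pmul2l // mulnC.
Qed.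

Lemma has_gdd_single (q : nat) : has_gdd q 'I_q 'I_1.
Proof.
exists unit, (fun _ => setT); split=> //.
- by rewrite cardsT card_prod !card_ord muln1.
- by move=> _ [i p] [j r] _ _ /= ->; rewrite !ord1.
- by move=> v w _; exists tt; rewrite !inE.
- by move=> [] [].
Qed.

(** The groups of a transversal design TD(q,q) are added as blocks. *)
Lemma has_gdd_affine_plane (q : nat) :
  (1 < q)%N -> has_oa q 'I_q -> has_gdd q 'I_(q * q) 'I_1.
Proof.
move=> q1 /has_gdd_of_oa gddq.
apply: (@has_gdd_card _ ('I_q * 'I_q)%type 'I_1) => //.
  by rewrite card_prod !card_ord.
apply: has_gdd_fill (has_gdd_single q).
by apply: has_gdd_card gddq => //; rewrite card_prod !card_ord muln1.
Qed.

Lemma etf_of_type_affine (R : realType) (q : nat) :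
  (1 < q)%N -> has_oa q 'I_q -> etf_of_type_exists R q.+2%:R (-1) q.+1%:R.
Proof.
move=> q1 oa.
apply: (@steiner_etf R q (q * q) q.+1 _ _ (q * q.+2)%N) => //.
- exact: has_gdd_affine_plane.
- by case: (q) => // p; rewrite mulSn mulnS; lia.
- by rewrite mulSn mulnS; lia.
- by rewrite [RHS]mulnC -!mulnA; congr (q * _)%N; rewrite mulnCA.
- by rewrite mulnA.
- by rewrite -mulnA ltn_Pmulr ?(leq_trans q1) ?leq_pmulr // ltnW.
- by apply: (@leq_trans (2 * q.+2)); rewrite ?leq_mul2r ?q1 ?orbT //; lia.
Qed.

Lemma has_gdd_triangle : has_gdd 2 'I_3 'I_1.
Proof.
have third (v w : 'I_3 * 'I_1) : v.1 != w.1 ->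
    exists x, forall y, (v.1 != y) && (w.1 != y) = (y == x).
  move=> ne; have /eqP/cards1P[x defx] : #|~: [set v.1; w.1]| = 1%N.
    by rewrite cardsCs setCK cards2 ne card_ord.
  exists x => y; have <- : (y \in [set x]) = (y == x) by rewrite in_set1.
  rewrite -defx !inE negb_or.
  by rewrite ![y == _]eq_sym.
exists 'I_3, (fun x => setX [set~ x] setT); split.
- by move=> x; rewrite cardsX cardsT cardsC1 !card_ord.
- by move=> x [i p] [j r] _ _ /= ->; rewrite !ord1.
- move=> v w /third[x xP]; exists x; rewrite !inE !andbT.
  by apply/andP; rewrite xP.
- move=> x y v w /third[z zP]; rewrite !inE !andbT => vx wx vy wy.
  have /eqP-> : x == z by rewrite -zP vx.
  by apply/esym/eqP; rewrite -zP vy.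
Qed.

Lemma etf_of_type_triangle (R : realType) : etf_of_type_exists R 6%:R (-1) 2%:R.
Proof.
exact: (@steiner_etf R 2 3 2 6 1 9 has_gdd_triangle).
Qed.

Local Notation Z2cube := ('Z_2 * 'Z_2 * 'Z_2)%type.

Definition sgn2 (C : numClosedFieldType) (t : 'Z_2) : C := (-1) ^+ t.

Definition chi8 (C : numClosedFieldType) (b x : Z2cube) : C :=
  sgn2 C (b.1.1 * x.1.1) * sgn2 C (b.1.2 * x.1.2) * sgn2 C (b.2 * x.2).

Lemma Z2_cases (t : 'Z_2) : t = 0 \/ t = 1.
Proof. by case: t => [[|[|//]] ?]; [left | right]; apply: val_inj. Qed.

Lemma sgn2D (C : numClosedFieldType) (s t : 'Z_2) : sgn2 C (s + t) = sgn2 C s * sgn2 C t.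
Proof.
by case: (Z2_cases s) (Z2_cases t) => -> [] ->;
  rewrite /sgn2 /= ?mulr1 ?mul1r ?mulrNN ?mulr1.
Qed.

Lemma sum_sgn2 (C : numClosedFieldType) (b : 'Z_2) :
  \sum_(t : 'Z_2) sgn2 C (b * t) = 2 *+ (b == 0).
Proof.
case: (Z2_cases b) => ->.
  under eq_bigr do rewrite mul0r; rewrite sumr_const card_ord.
  by rewrite eqxx mulr1n /sgn2 expr0.
under eq_bigr do rewrite mul1r.
by rewrite big_ord_recl big_ord1 /sgn2 /= expr0 expr1 subrr.
Qed.

Lemma chi8C (C : numClosedFieldType) b x : chi8 C b x = chi8 C x b.
Proof.
by rewrite /chi8 [b.1.1 * _]mulrC [b.1.2 * _]mulrC [b.2 * _]mulrC.
Qed.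

Lemma chi8D (C : numClosedFieldType) b x y : chi8 C b (x + y) = chi8 C b x * chi8 C b y.
Proof. by rewrite /chi8 /= !mulrDr !sgn2D; ring. Qed.

Lemma chi8Dl (C : numClosedFieldType) b b' x :
  chi8 C (b + b') x = chi8 C b x * chi8 C b' x.
Proof. by rewrite chi8C chi8D ![chi8 C x _]chi8C. Qed.

Lemma chi80 (C : numClosedFieldType) b : chi8 C b 0 = 1.
Proof. by rewrite /chi8 /= !mulr0 /sgn2 !expr0 !mulr1. Qed.

Lemma sum_chi8 (C : numClosedFieldType) b : \sum_x chi8 C b x = 8 *+ (b == 0).
Proof.
transitivity ((\sum_t sgn2 C (b.1.1 * t)) * (\sum_t sgn2 C (b.1.2 * t)) *
              (\sum_t sgn2 C (b.2 * t))).
  rewrite big_distrlr /= pair_bigA big_distrlr /= pair_bigA /=.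
  by apply: eq_bigr => -[[]].
rewrite !sum_sgn2; case: b => [[b1 b2] b3] /=.
rewrite (_ : ((b1, b2, b3) == 0) = [&& b1 == 0, b2 == 0 & b3 == 0]); last first.
  by rewrite andbA.
by case: (b1 == 0); case: (b2 == 0); case: (b3 == 0);
  rewrite ?mulr1n ?mulr0n ?mul0r ?mulr0 ?mul0r // -!natrM.
Qed.

Lemma add8 (x : Z2cube) : x + x = 0.
Proof.
case: x => [[a b] c].
by case: (Z2_cases a) (Z2_cases b) (Z2_cases c) => -> [] -> [] ->; apply/eqP.
Qed.

Lemma chi8_sqr (C : numClosedFieldType) b x : chi8 C b x * chi8 C b x = 1.
Proof. by rewrite -chi8D add8 chi80. Qed.

Lemma conj_chi8 (C : numClosedFieldType) b x : (chi8 C b x)^* = chi8 C b x.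
Proof.
by rewrite /chi8 /sgn2 !rmorphM /= !rmorphXn /= !rmorphN !rmorph1.
Qed.

Lemma chi8_sign (C : numClosedFieldType) b x : chi8 C b x = 1 \/ chi8 C b x = -1.
Proof.
have /eqP := chi8_sqr C b x; rewrite -expr2 sqrf_eq1 => /orP[] /eqP ->; by [left | right].
Qed.

(** Hoggar's lines form an orbit of the three-qubit Pauli group: [hoggar (a, b)]
    is the translate of this vector by [a], multiplied by the character
    of [b]. *)
Definition fiducial (C : numClosedFieldType) (x : Z2cube) : C :=
  if x == 0 then 2 * 'i - 1 else 1.

Definition hoggar (C : numClosedFieldType)
    (n : Z2cube * Z2cube) (x : Z2cube) : C :=
  chi8 C n.2 x * fiducial C (x + n.1).

(** The fiducial vector is constant up to a correction at 0, so every inner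
    product is a character sum plus three corrections: with [d] and [e] the
    differences of the two labels, the value is
    [8 [d = 0] + (2i-2) - (2i+2) chi_d(e) + 8 [e = 0]], of modulus 4 or, for
    [d = e = 0], equal to 12. *)
Lemma hoggar_family (C : numClosedFieldType) : etf_family (@hoggar C) 12 4 96.
Proof.
have gapE x : fiducial C x = 1 + (2 * 'i - 2) *+ (x == 0).
  by rewrite /fiducial; case: (x == 0) => /=; rewrite ?mulr1n ?mulr0n ?addr0; ring.
have gapcE x : (fiducial C x)^* = 1 + (- 2 * 'i - 2) *+ (x == 0).
  rewrite /fiducial; case: (x == 0) => /=; rewrite ?mulr1n ?mulr0n ?addr0 ?conjC1 //.
  by rewrite rmorphB rmorphM /= conjCi rmorph1 conjC_nat; ring.
have sum_delta (F : Z2cube -> C) (e : Z2cube) (z : C) :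
    \sum_(x : Z2cube) z *+ (x + e == 0) * F x = z * F e.
  rewrite (bigD1 e) //= add8 eqxx mulr1n big1 ?addr0 // => x ne.
  rewrite (_ : (x + e == 0) = false) ?mulr0n ?mul0r //.
  by apply: contraNF ne => /eqP eqx; rewrite -[x]addr0 -(add8 e) addrA eqx add0r.
have key (d e : Z2cube) :
    \sum_(x : Z2cube) chi8 C d x * (fiducial C x * (fiducial C (x + e))^*) =
    8 *+ (d == 0) + (2 * 'i - 2) + (- 2 * 'i - 2) * chi8 C d e + 8 *+ (e == 0).
  rewrite (eq_bigr (fun x => chi8 C d x + (2 * 'i - 2) *+ (x + 0 == 0) * chi8 C d x +
      (- 2 * 'i - 2) *+ (x + e == 0) * chi8 C d x +
      (2 * 'i - 2) *+ (x + 0 == 0) *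
        (chi8 C d x * ((- 2 * 'i - 2) *+ (x + e == 0))))) => [|x _]; last first.
    by rewrite gapE gapcE addr0; ring.
  rewrite !big_split /= sum_chi8 !sum_delta chi80 add0r mulr1 mul1r mulrnAr.
  congr (_ + _ *+ _).
  have := sqrCi C; rewrite expr2 => ii.
  by transitivity (4 - 4 * ('i * 'i) : C); [ring | rewrite ii; ring].
have innerE n n' : \sum_x hoggar C n x * (hoggar C n' x)^* =
    chi8 C (n.2 + n'.2) n.1 *
    \sum_x chi8 C (n.2 + n'.2) x * (fiducial C x * (fiducial C (x + (n.1 + n'.1)))^*).
  rewrite (reindex_inj (addIr n.1)) mulr_sumr; apply: eq_bigr => x _ /=.
  rewrite /hoggar rmorphM /= conj_chi8 addrA -[x + n.1 + n.1]addrA add8 addr0.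
  by rewrite !chi8Dl !chi8D; ring.
split.
- by move=> n; rewrite innerE key !add8 eqxx chi8C !chi80 /= !mulr1n; ring.
- move=> [a b] [a' b'] ne; rewrite innerE normrM /= key.
  set d := b + b'; set e := a + a'.
  have norm_chi x : `|chi8 C d x| = 1.
    by case: (chi8_sign C d x) => ->; rewrite ?normrN normr1.
  rewrite norm_chi mul1r.
  have eq0 (x y : Z2cube) : (x + y == 0) = (x == y).
    by rewrite -[X in _ == X](add8 y) (inj_eq (addIr y)).
  have : (d != 0) || (e != 0) by rewrite -negb_and !eq0 andbC -xpair_eqE.
  have [-> /= | d0 _] := eqVneq d 0.
    move=> /negPf ->; rewrite chi8C chi80 /= !mulr1n !mulr0n.
    by rewrite (_ : _ + _ = 4) ?ger0_norm //; ring.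
  have [-> | e0] := eqVneq e 0.
    rewrite chi80 /= !mulr1n !mulr0n.
    by rewrite (_ : _ + _ = 4) ?ger0_norm //; ring.
  case: (chi8_sign C d e) => -> /=; rewrite !mulr0n.
    by rewrite -normrN (_ : - (_ + _) = 4) ?ger0_norm //; ring.
  rewrite mulrN1 (_ : _ + _ = 4 * 'i :> C); last by ring.
  by rewrite normrM normCi mulr1 ger0_norm.
move=> x x'; rewrite -(pair_bigA _ (fun a b =>
  (hoggar C (a, b) x)^* * hoggar C (a, b) x')) /=.
rewrite (eq_bigr (fun a => (\sum_b chi8 C b (x + x')) *
  ((fiducial C (x + a))^* * fiducial C (x' + a)))).
  have -> : \sum_b chi8 C b (x + x') = 8 *+ (x + x' == 0).
    by rewrite -sum_chi8; apply: eq_bigr => b _; rewrite chi8C.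
  rewrite -mulr_sumr.
  have -> : (x + x' == 0) = (x == x').
    by rewrite -[X in _ == X](add8 x') (inj_eq (addIr x')).
  case: eqP => [<- | _]; last by rewrite !mulr0n mul0r.
  rewrite !mulr1n (reindex_inj (addrI x)) /=.
  have := key 0 0; rewrite eqxx chi80 /= !mulr1n => key00.
  have -> : 96 = 8 * (8 + (2 * 'i - 2) + (- 2 * 'i - 2) * 1 + 8) :> C by ring.
  rewrite -key00; congr (_ * _); apply: eq_bigr => a _.
  by rewrite addrA add8 add0r addr0 chi8C chi80 mul1r mulrC.
move=> a _; rewrite mulr_suml; apply: eq_bigr => b _.
by rewrite /hoggar rmorphM /= conj_chi8 chi8D; ring.
Qed.

Lemma etf_of_type_hoggar (R : realType) : etf_of_type_exists R 12%:R (-1) 3%:R.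
Proof.
apply: (etf_of_type_family _ _ (@hoggar_family R[i]) (m := 32));
  by rewrite ?ltr0n // !card_prod !card_ord.
Qed.

(** * The theorem *)

Lemma has_gdd_weighted_bibd (K M U : nat) :
  bibd1_exists U K -> has_oa K 'I_M -> (1 < U)%N /\ has_gdd K 'I_U 'I_M.
Proof.
move=> bibd oa; have [_ [_ [_ [[K2 _ KU _] _ _ _ _]]]] := bibd.
split; first exact: leq_trans KU.
apply: has_gdd_card (has_gdd_weight (ltnW K2) (gdd_exists_has_gdd bibd) oa) => //.
by rewrite card_prod !card_ord mul1n.
Qed.

Lemma has_gdd_power_of_td (K M J : nat) :
  (1 < K)%N -> (0 < J)%N ->
  (forall j, (j < J)%N -> has_gdd K 'I_K 'I_(M * K ^ j)) ->
  (1 < K ^ J)%N /\ has_gdd K 'I_(K ^ J) 'I_M.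
Proof.
move=> K1 J0 tds; split; first by rewrite -(exp1n J) ltn_exp2r.
apply: has_gdd_power => // j jJ; apply: has_gdd_card (tds j jJ) => //.
by rewrite card_prod !card_ord mulnC.
Qed.

(** The common part of the five series: a seed of type [(K, -1, s.+1)] together
    with transversal designs of all orders [M * K ^ j] covers [U = 1] and all
    positive powers of [K] at once. *)
Lemma etf_of_type_series (R : realType) (K s M U : nat) :
  etf_of_type_exists R K%:R (-1) s.+1%:R -> (1 < K)%N -> (0 < s)%N -> (s %| K - 2)%N ->
  M.+1 = (s.+1 * K.-1)%N -> (forall j, has_oa K 'I_(M * K ^ j)) ->
  (exists J, U = (K ^ J)%N) \/ bibd1_exists U K ->
  etf_of_type_exists R K%:R (-1) ((M%:R * U%:R + 1) / (K%:R - 1)).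
Proof.
move=> etfS K1 s0 sK defM oas caseU.
apply: (@etf_of_type_gdd R K M U s.+1) => //.
- rewrite (_ : s.+1%:~R - 1 = s%:R); last by rewrite -[s.+1%:~R]/(s.+1%:R) -natr1 addrK.
  rewrite -natrB //.
  by case/dvdnP: sK => q ->; rewrite natrM mulfK ?pnatr_eq0 -?lt0n // rpred_nat.
- have -> : K%:Z - 1 = K.-1 by lia.
  by rewrite -PoszM -defM; lia.
have oaM : has_oa K 'I_M by have := oas 0%N; rewrite muln1.
case: caseU => [[[|J] ->] | bibd]; first by left.
  by right; apply: has_gdd_power_of_td => // j _; apply: has_gdd_of_oa.
by right; apply: has_gdd_weighted_bibd.
Qed.

Theorem theorem4p4 (R : realType) :
  (forall (K M : nat) (S : int),
     etf_of_type_exists R K%:R (-1) S%:~R ->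
     (K%:R - 2) / (S%:~R - 1) \is a @Num.int rat ->
     M%:Z = S * (K%:Z - 1) - 1 ->
     td_exists K M ->
     forall U : nat,
       [\/ U = 1%N \/ U = K,
           bibd1_exists U K
         | exists J : nat, [/\ (2 <= J)%N, U = (K ^ J)%N
             & forall j : nat, (1 <= j <= J - 1)%N -> td_exists K (M * K ^ j)]] ->
       etf_of_type_exists R K%:R (-1) ((M%:R * U%:R + 1) / (K%:R - 1)))
  /\
  (forall U : nat,
     [/\ (exists J : nat, U = (6 ^ J)%N) \/ bibd1_exists U 6 ->
           etf_of_type_exists R 6 (-1) ((9 * U%:R + 1) / 5),
         (exists J : nat, U = (6 ^ J)%N) \/ bibd1_exists U 6 ->
           etf_of_type_exists R 6 (-1) ((24 * U%:R + 1) / 5),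
         (exists J : nat, U = (7 ^ J)%N) \/ bibd1_exists U 7 ->
           etf_of_type_exists R 7 (-1) ((35 * U%:R + 1) / 6),
         (exists J : nat, U = (10 ^ J)%N) \/ bibd1_exists U 10 ->
           etf_of_type_exists R 10 (-1) ((80 * U%:R + 1) / 9)
       & (exists J : nat, U = (12 ^ J)%N) \/ bibd1_exists U 12 ->
           etf_of_type_exists R 12 (-1) ((32 * U%:R + 1) / 11)]).
Proof.
split=> [K M S etfS int_s defM td U caseU | U].
  apply: etf_of_type_gdd etfS int_s defM _.
  have K1 : (1 < K)%N by have [? [? [? [[K2 _ _ _] _ _ _ _]]]] := td.
  have gddK := gdd_exists_has_gdd td.
  case: caseU => [[-> | ->] | bibd | [J [J2 -> tds]]]; first by left.
  - by right.
  - by right; apply: has_gdd_weighted_bibd bibd (has_gdd_oa gddK).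
  right; apply: has_gdd_power_of_td => //; first exact: ltnW.
  case=> [|j] ltj; first by rewrite muln1.
  by apply: gdd_exists_has_gdd (tds _ _); lia.
split=> caseU.
- have -> : 5 = 6%:R - 1 :> rat by ring.
  exact: (etf_of_type_series (etf_of_type_triangle R) _ _ _ _ has_oa_9_6 caseU).
- have -> : 5 = 6%:R - 1 :> rat by ring.
  apply: (etf_of_type_series (etf_of_type_affine R _ _) _ _ _ _ has_oa_24_6 caseU) => //.
  by apply: (@has_oa_prime_power 2 2).
- have -> : 6 = 7%:R - 1 :> rat by ring.
  apply: (etf_of_type_series (etf_of_type_affine R _ _) _ _ _ _ has_oa_35_7 caseU) => //.
  by apply: has_oa_prime.
- have -> : 9 = 10%:R - 1 :> rat by ring.
  apply: (etf_of_type_series (etf_of_type_affine R _ _) _ _ _ _ has_oa_80_10 caseU) => //.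
  by apply: (@has_oa_prime_power 2 3).
have -> : 11 = 12%:R - 1 :> rat by ring.
exact: (etf_of_type_series (etf_of_type_hoggar R) _ _ _ _ has_oa_32_12 caseU).
Qed.
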